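(* Let $\Omega=\mathbb{T}^d=\mathbb{R}^d/\mathbb{Z}^d$, let $\mathcal{L}$ denote Lebesgue (Haar) measure, and let $T:\Omega\to\Omega$ be a measurable map satisfying the following (Assumption M): (M1) there are finitely many open sets $Y_1,\dots,Y_p\subset\Omega$ forming a partition (mod $0$) of $\Omega$, with $\Omega=\bigcup_{j=1}^p\overline{Y_j}$, such that $T$ has a Lipschitz extension to each closure $\overline{Y_j}$ with a uniform Lipschitz constant $\eta>1$: $\|T(x)-T(y)\|\le \eta\|x-y\|$ for all $x,y\in\overline{Y_j}$, $j=1,\dots,p$; (M2) $T$ preserves a Borel probability measure $\nu$ which is mixing, and there are a Banach space $\mathcal{B}$ included in $L^\infty_{\mathcal{L}}$ and a constant $C$ depending only on $T$ such that for all $h\in\mathcal{B}$, $f\in L^1_\nu$ and $m\ge 1$ $$\left|\int (f\circ T^m)\, h\, d\nu-\int f\,d\nu\int h\,d\nu\right|\le C\,\|h\|_{\mathcal{B}}\,\|f\|_{L^1_\nu}\,m^{-2};$$ (M3) $\nu$ is equivalent to $\mathcal{L}$ with density in $L^\infty_{\mathcal{L}}$. Let $\xi_0,\xi_1,\dots$ be i.i.d. random vectors satisfying the following (Assumption N): they take values in $S=\{u\in\mathbb{R}^d:\|u\|\le 1\}$ with common distribution $\theta$, where $d\theta(\xi)=\rho(\xi)\,d\mathcal{L}(\xi)$, $\rho\in L^\infty_{\mathcal{L}}$, $\int_S\rho\,d\mathcal{L}=1$; the $d$ components of each $\xi_i$ are independent with a common density $\rho'$, and $\rho$ is the product of these marginals.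 Let $\epsilon>0$ and $z\in\Omega$, and on $\Omega\times S^{\mathbb{N}}$ with probability $\mathbb{P}=\nu\times\theta^{\mathbb{N}}$ consider the process $$X_m(x,\overline{\xi})=-\log\big\|T^m x+\epsilon\,\xi_m-z\big\|,\qquad m\ge 0,\ \overline{\xi}=(\xi_0,\xi_1,\dots).$$ Let $\tau>0$ and let $(u_m)_{m\in\mathbb{N}}$ be a sequence of real levels with $m\,\mathbb{P}(X_0>u_m)\to\tau$ as $m\to\infty$. Then conditions $D_2(u_m)$ and $D'(u_m)$ hold for $X_0,X_1,X_2,\dots$.
   Context: On the torus $\|\cdot\|$ denotes the distance induced by a norm $\|\cdot\|$ on $\mathbb{R}^d$, and addition is taken mod $\mathbb{Z}^d$. ''$\nu$ equivalent to $\mathcal{L}$'' means that there is a constant $\iota>0$ such that $\iota^{-1}\mathcal{L}(A)\le\nu(A)\le\iota\,\mathcal{L}(A)$ for every measurable $A$. For a stationary process $X_0,X_1,\dots$ put $M_\ell=\max\{X_0,\dots,X_{\ell-1}\}$. Condition $D_2(u_m)$: for all $\ell,t$ and $m$, $$\big|\mathbb{P}\big(X_0>u_m,\ \max\{X_t,\dots,X_{t+\ell-1}\}\le u_m\big)-\mathbb{P}(X_0>u_m)\,\mathbb{P}(M_\ell\le u_m)\big|\le\gamma(m,t),$$ where $\gamma(m,t)$ is decreasing in $t$ for each $m$ and $m\,\gamma(m,t_m)\to 0$ as $m\to\infty$ for some sequence $t_m=o(m)$. Condition $D'(u_m)$: with $(t_m)$ the sequence from $D_2(u_m)$, there is a sequence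 of integers $(k_m)_{m\in\mathbb{N}}$ with $k_m\to\infty$ and $k_m t_m=o(m)$ such that $$\lim_{m\to\infty} m\sum_{j=1}^{\lfloor m/k_m\rfloor}\mathbb{P}(X_0>u_m,\ X_j>u_m)=0.$$ *)

(* Defs.v *)
From HB Require Import structures.
From mathcomp Require Import all_boot all_order all_algebra.
From mathcomp Require Import generic_quotient ring_quotient.
From mathcomp Require Import all_classical all_reals all_analysis.

Set Implicit Arguments.
Unset Strict Implicit.
Unset Printing Implicit Defensive.

Import Order.TTheory GRing.Theory Num.Theory.
Import numFieldNormedType.Exports.

Local Open Scope classical_set_scope.
Local Open Scope ring_scope.
Local Open Scope quotient_scope.

Section row_borel.
Variables (R : realType) (d : nat).

HB.instance Definition _ := @isMeasurable.Build
  (sigma_display (@open 'rV[R]_d)) 'rV[R]_d <<s @open 'rV[R]_d >>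
  (@sigma_algebra0 _ setT _) (@sigma_algebraC _ _)
  (@sigma_algebra_bigcup _ setT _).

Lemma open_measurable_rV (U : set 'rV[R]_d) : open U -> measurable U.
Proof. exact: sub_sigma_algebra. Qed.

Lemma measurable_coord (i : 'I_d) :
  measurable_fun setT (fun v : 'rV[R]_d => v ord0 i : measurableTypeR R).
Proof.
apply: (measurability _ (measurable_realfun.RGenOpens.measurableE R)).
move=> _ [_ [x [y ->]] <-]; rewrite setTI; apply: open_measurable_rV.
have /continuousP : continuous (fun v : 'rV[R]_d => v ord0 i).
  exact: coord_continuous.
by apply; exact: interval_open.
Qed.

Definition tuple_row (t : d.-tuple (measurableTypeR R)) : 'rV[R]_d :=
  \row_i tnth t i.

Lemma measurable_tuple_row : measurable_fun setT tuple_row.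
Proof.
apply: (measurability (@open 'rV[R]_d)) => // _ [U oU <-]; rewrite setTI.
pose box (q : {ffun 'I_d -> rat * rat}) : set 'rV[R]_d :=
  [set v | forall i, ratr (q i).1 < v ord0 i < ratr (q i).2].
pose F q := if pselect (box q `<=` U) then tuple_row @^-1` box q else set0.
have -> : tuple_row @^-1` U = \bigcup_q F q.
  apply/seteqP; split=> [t Ut|t [q _]]; last first.
    by rewrite /F; case: pselect => //= qU; exact: qU.
  have /nbhs_ballP[e /= e0 eU] : nbhs (tuple_row t) U by exact: open_nbhs_nbhs.
  have qP i : exists p : rat * rat,
      (tnth t i - e < ratr p.1 < tnth t i) /\
      (tnth t i < ratr p.2 < tnth t i + e).
    have [|p1] := @rat_in_itvoo R (tnth t i - e) (tnth t i).
      by rewrite ltrBlDr ltrDl.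
    rewrite in_itv /= => p1P.
    have [|p2] := @rat_in_itvoo R (tnth t i) (tnth t i + e).
      by rewrite ltrDl.
    by rewrite in_itv /= => p2P; exists (p1, p2).
  have [q qE] := choice qP.
  exists [ffun i => q i] => //; rewrite /F; case: pselect => [qU|[]] /=.
    by move=> i /=; rewrite ffunE mxE; case: (qE i) => /andP[_ ->] /andP[-> _].
  move=> v vq; apply: eU; split=> // i j; rewrite ord1 {i}.
  have := vq j; rewrite ffunE => /andP[v1 v2].
  case: (qE j) => /andP[q1 q2] /andP[q3 q4].
  rewrite /ball /= mxE ltr_distlC.
  by rewrite (lt_trans q1 v1) (lt_trans v2 q4).
apply: countable_bigcupT_measurable => [|q]; first exact: countableP.
rewrite /F; case: pselect => //= qU.
have -> : tuple_row @^-1` box q = \bigcap_(i in [set: 'I_d])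
    ((fun t : d.-tuple (measurableTypeR R) => tnth t i) @^-1`
      `]ratr (q i).1, ratr (q i).2[%classic).
  apply/seteqP; split=> t /= tq i => [_|].
    by have := tq i; rewrite mxE /= in_itv.
  by have := tq i Logic.I; rewrite mxE /= in_itv.
apply: fin_bigcap_measurable => [|i _]; first exact: finite_finset.
rewrite -[X in measurable X]setTI.
by apply: (@measurable_tnth _ (measurableTypeR R)) => //; exact: measurable_itv.
Qed.

End row_borel.

Lemma product_sigma_finite d1 d2 (T1 : measurableType d1)
    (T2 : measurableType d2) (R : realType)
    (m1 : {sigma_finite_measure set T1 -> \bar R})
    (m2 : {sigma_finite_measure set T2 -> \bar R}) :
  sigma_finite setT (m1 \x m2)%E.
Proof.
have /sigma_finiteP[F [TF ndF Foo]] := sigma_finiteT m1.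
have /sigma_finiteP[G [TG ndG Goo]] := sigma_finiteT m2.
exists (fun n => F n `*` G n).
  rewrite -setXTT TF TG predeqE => -[x y]; split.
    move=> [/= [n _ Fnx] [k _ Gky]]; exists (maxn n k) => //; split.
    - by move: x Fnx; exact/subsetPset/ndF/leq_maxl.
    - by move: y Gky; exact/subsetPset/ndG/leq_maxr.
  by move=> [n _ []/= ? ?]; split; exists n.
move=> k; have [? ?] := Foo k; have [? ?] := Goo k.
split; first exact: measurableX.
by rewrite product_measure1E// lte_mul_pinfty// ge0_fin_numE.
Qed.

Section lebesgue_tuple.
Variable R : realType.
Local Notation MR := (measurableTypeR R).
Local Open Scope ereal_scope.

Section step.
Variables (n : nat) (m : {sigma_finite_measure set (n.-tuple MR) -> \bar R}).

Definition consp (p : MR * n.-tuple MR) : n.+1.-tuple MR :=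
  [the n.+1.-tuple MR of p.1 :: p.2].

Definition unconsp (t : n.+1.-tuple MR) : MR * n.-tuple MR :=
  (thead t, [tuple of behead t]).

Lemma consp_measurable : measurable_fun setT consp.
Proof. exact: measurable_cons. Qed.

Lemma unconsp_measurable : measurable_fun setT unconsp.
Proof.
apply: measurable_fun_pair; first exact: measurable_tnth.
exact: measurable_behead.
Qed.

Lemma conspK : cancel consp unconsp.
Proof.
move=> [x t]; rewrite /consp /unconsp /=; congr pair => //.
exact/val_inj.
Qed.

Definition lebesgue_cons (A : set (n.+1.-tuple MR)) : \bar R :=
  ((@lebesgue_measure R) \x m) (consp @^-1` A).

Let mpre A : measurable A -> measurable (consp @^-1` A).
Proof. by move=> mA; rewrite -[X in measurable X]setTI; exact: consp_measurable. Qed.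

Let lebesgue_cons0 : lebesgue_cons set0 = 0.
Proof. by rewrite /lebesgue_cons preimage_set0 measure0. Qed.

Let lebesgue_cons_ge0 A : 0 <= lebesgue_cons A.
Proof. exact: measure_ge0. Qed.

Let lebesgue_cons_sigma_additive : semi_sigma_additive lebesgue_cons.
Proof.
move=> F mF tF mUF; rewrite /lebesgue_cons preimage_bigcup.
apply: measure_semi_sigma_additive.
- by move=> k; exact: mpre.
- apply/trivIsetP => /= i j _ _ ij; rewrite -preimage_setI.
  by move/trivIsetP : tF => /(_ _ _ _ _ ij) ->//; rewrite preimage_set0.
- by rewrite -preimage_bigcup; exact: mpre.
Qed.

HB.instance Definition _ := isMeasure.Build _ _ _ lebesgue_cons
  lebesgue_cons0 lebesgue_cons_ge0 lebesgue_cons_sigma_additive.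

Let lebesgue_cons_sigma_finite : sigma_finite setT lebesgue_cons.
Proof.
have [F FT Foo] := product_sigma_finite (@lebesgue_measure R) m.
exists (fun k => unconsp @^-1` F k).
  by rewrite -preimage_bigcup -FT preimage_setT.
move=> k; have [mFk Fkoo] := Foo k; split.
  by rewrite -[X in measurable X]setTI; exact: unconsp_measurable.
rewrite /lebesgue_cons -comp_preimage.
by rewrite (_ : unconsp \o consp = id) ?preimage_id//; exact/funext/conspK.
Qed.

HB.instance Definition _ := @Measure_isSigmaFinite.Build _ _ _ lebesgue_cons
  lebesgue_cons_sigma_finite.

End step.

Fixpoint lebesgue_tuple (n : nat) :
    {sigma_finite_measure set (n.-tuple MR) -> \bar R} :=
  match n return {sigma_finite_measure set (n.-tuple MR) -> \bar R} with
  | 0 => [the {sigma_finite_measure set (0.-tuple MR) -> \bar R} of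
           dirac [tuple]]
  | k.+1 => [the {sigma_finite_measure set (k.+1.-tuple MR) -> \bar R} of
              lebesgue_cons (lebesgue_tuple k)]
  end.

End lebesgue_tuple.

(* Lebesgue measure on the Borel sets of R^d: d-fold product of the Lebesgue
   measure on R, transported from d-tuples to row vectors *)
Section lebesgue_rV.
Variables (R : realType) (d : nat).
Local Open Scope ereal_scope.

Definition lebesgue_rV (A : set 'rV[R]_d) : \bar R :=
  lebesgue_tuple R d (@tuple_row R d @^-1` A).

Let mpre (A : set 'rV[R]_d) :
  measurable A -> measurable (@tuple_row R d @^-1` A).
Proof.
by move=> mA; rewrite -[X in measurable X]setTI; exact: measurable_tuple_row.
Qed.

Let lebesgue_rV0 : lebesgue_rV set0 = 0.
Proof. by rewrite /lebesgue_rV preimage_set0 measure0. Qed.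

Let lebesgue_rV_ge0 A : 0 <= lebesgue_rV A.
Proof. exact: measure_ge0. Qed.

Let lebesgue_rV_sigma_additive : semi_sigma_additive lebesgue_rV.
Proof.
move=> F mF tF mUF; rewrite /lebesgue_rV preimage_bigcup.
apply: measure_semi_sigma_additive.
- by move=> k; exact: mpre.
- apply/trivIsetP => /= i j _ _ ij; rewrite -preimage_setI.
  by move/trivIsetP : tF => /(_ _ _ _ _ ij) ->//; rewrite preimage_set0.
- by rewrite -preimage_bigcup; exact: mpre.
Qed.

HB.instance Definition _ := isMeasure.Build _ _ _ lebesgue_rV
  lebesgue_rV0 lebesgue_rV_ge0 lebesgue_rV_sigma_additive.

End lebesgue_rV.

Section torus.
Variables (R : realType) (d : nat).

Definition int_lattice : {pred 'rV[R]_d} :=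
  [pred v : 'rV[R]_d | [forall i, v ord0 i \is a Num.int]].

Lemma int_lattice_zmod_closed : zmod_closed int_lattice.
Proof.
split=> [|u v /forallP hu /forallP hv]; apply/forallP => i.
  by rewrite mxE; exact: rpred0.
by rewrite !mxE; exact: rpredB.
Qed.

HB.instance Definition _ :=
  GRing.isZmodClosed.Build 'rV[R]_d int_lattice int_lattice_zmod_closed.

Definition torus : Type := ring_quotient.Quotient.quot int_lattice.

HB.instance Definition _ := GRing.Zmodule.on torus.
HB.instance Definition _ := EqQuotient.on torus.

(* quotient topology; not copied from quotient_topology, whose choiceType
   structure differs from the one of the quotient group *)
Definition torus_open (U : set torus) := open (\pi_torus @^-1` U).

Lemma torus_openT : torus_open setT.
Proof. exact: openT. Qed.

Lemma torus_openI (U V : set torus) :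
  torus_open U -> torus_open V -> torus_open (U `&` V).
Proof. exact: openI. Qed.

Lemma torus_open_bigcup (I : Type) (f : I -> set torus) :
  (forall i, torus_open (f i)) -> torus_open (\bigcup_i f i).
Proof. by move=> fo; apply: bigcup_open => i _; exact: fo. Qed.

HB.instance Definition _ := @isOpenTopological.Build torus
  torus_open torus_openT torus_openI torus_open_bigcup.
HB.instance Definition _ := isPointed.Build torus 0.
HB.instance Definition _ := @isMeasurable.Build
  (sigma_display (@open torus)) torus <<s @open torus >>
  (@sigma_algebra0 _ setT _) (@sigma_algebraC _ _)
  (@sigma_algebra_bigcup _ setT _).

Definition to_torus (v : 'rV[R]_d) : torus := \pi_torus v.

Lemma measurable_to_torus : measurable_fun setT to_torus.
Proof.
apply: (measurability (@open torus)) => // _ [U oU <-]; rewrite setTI.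
exact: open_measurable_rV.
Qed.

Definition unit_cube : set 'rV[R]_d := [set v | forall i, 0 <= v ord0 i < 1].

Lemma measurable_unit_cube : measurable unit_cube.
Proof.
have -> : unit_cube = \bigcap_(i in [set: 'I_d])
    ((fun v : 'rV[R]_d => v ord0 i) @^-1` `[0, 1[%classic).
  apply/seteqP; split=> v /= vc i => [_|]; first by rewrite /= in_itv /=.
  by have := vc i Logic.I; rewrite /= in_itv.
apply: fin_bigcap_measurable => [|i _]; first exact: finite_finset.
rewrite -[X in measurable X]setTI.
by apply: (measurable_coord i) => //; exact: measurable_itv.
Qed.

(* Lebesgue (Haar) probability measure on the torus *)
Definition lebesgue_torus (A : set torus) : \bar R :=
  lebesgue_rV (unit_cube `&` to_torus @^-1` A).

Local Open Scope ereal_scope.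

Let mpre (A : set torus) :
  measurable A -> measurable (unit_cube `&` to_torus @^-1` A).
Proof.
move=> mA; apply: measurableI; first exact: measurable_unit_cube.
by rewrite -[X in measurable X]setTI; exact: measurable_to_torus.
Qed.

Let lebesgue_torus0 : lebesgue_torus set0 = 0.
Proof. by rewrite /lebesgue_torus preimage_set0 setI0 measure0. Qed.

Let lebesgue_torus_ge0 A : 0 <= lebesgue_torus A.
Proof. exact: measure_ge0. Qed.

Let lebesgue_torus_sigma_additive : semi_sigma_additive lebesgue_torus.
Proof.
move=> F mF tF mUF; rewrite /lebesgue_torus preimage_bigcup setI_bigcupr.
apply: measure_semi_sigma_additive.
- by move=> k; exact: mpre.
- apply/trivIsetP => /= i j _ _ ij; rewrite setIACA setIid -preimage_setI.
  by move/trivIsetP : tF => /(_ _ _ _ _ ij) ->//; rewrite preimage_set0 setI0.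
- by rewrite -setI_bigcupr -preimage_bigcup; exact: mpre.
Qed.

HB.instance Definition _ := isMeasure.Build _ _ _ lebesgue_torus
  lebesgue_torus0 lebesgue_torus_ge0 lebesgue_torus_sigma_additive.

End torus.

Section sequence_space.
Variables (disp : measure_display) (E : measurableType disp).

(* E^nat with the product sigma-algebra *)
Definition seq_space : Type := nat -> E.

HB.instance Definition _ := Pointed.on seq_space.

Definition seq_cylinder : set (set seq_space) :=
  [set A | exists (n : nat) (B : set E),
    measurable B /\ A = (fun xi : seq_space => xi n) @^-1` B].

HB.instance Definition _ := @isMeasurable.Build
  (sigma_display seq_cylinder) seq_space <<s seq_cylinder >>
  (@sigma_algebra0 _ setT _) (@sigma_algebraC _ _)
  (@sigma_algebra_bigcup _ setT _).

(* Theta is the infinite product theta^nat: its value on each measurable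
   rectangle, which determines it *)
Definition is_product_law (R : realType) (theta : probability E R)
    (Theta : probability seq_space R) : Prop :=
  forall (n : nat) (B : 'I_n -> set E), (forall i, measurable (B i)) ->
    Theta [set xi : seq_space | forall i : 'I_n, B i (xi i)] = (\prod_(i < n) theta (B i))%E.

End sequence_space.

Record vnorm (R : realType) (d : nat) : Type := VNorm {
  vnorm_fun :> 'rV[R]_d -> R ;
  vnormD : forall u v, vnorm_fun (u + v) <= vnorm_fun u + vnorm_fun v ;
  vnormZ : forall (a : R) v, vnorm_fun (a *: v) = `|a| * vnorm_fun v ;
  vnorm_eq0 : forall v, vnorm_fun v = 0 -> v = 0
}.

Section torus_norm.
Variables (R : realType) (d : nat) (N : vnorm R d).

(* distance from x to 0 on the torus; the distance from x to y is
   tnorm (x - y) *)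
Definition tnorm (x : torus R d) : R := inf (N @` [set v | to_torus v = x]).

Definition noise : Type := {v : 'rV[R]_d | N v <= 1}.

Lemma vnorm0_le1 : N 0 <= 1.
Proof. by rewrite -(scale0r 0) vnormZ normr0 mul0r. Qed.

HB.instance Definition _ := gen_eqMixin noise.
HB.instance Definition _ := gen_choiceMixin noise.
HB.instance Definition _ := isPointed.Build noise (exist _ 0 vnorm0_le1).

Definition noise_val (s : noise) : 'rV[R]_d := sval s.

HB.instance Definition _ := @isMeasurable.Build (preimage_display noise_val)
  noise (g_sigma_algebra_preimage noise_val)
  (@measurable0 _ (g_sigma_algebra_preimageType noise_val))
  (@measurableC _ (g_sigma_algebra_preimageType noise_val))
  (@bigcupT_measurable _ (g_sigma_algebra_preimageType noise_val)).

End torus_norm.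

Section assumptions.
Variables (R : realType) (d : nat) (N : vnorm R d).
Local Notation Omega := (torus R d).
Local Notation Leb := (@lebesgue_torus R d).

(* Tj is the extension to the closure of Y j of the restriction of T to Y j *)
Definition piecewise_lipschitz (T : Omega -> Omega) : Prop :=
  exists (p : nat) (Y : 'I_p -> set Omega) (eta : R),
    [/\ forall j, open (Y j),
        trivIset setT Y /\ Leb (~` \bigcup_j Y j) = 0%E,
        \bigcup_j closure (Y j) = setT,
        1 < eta &
        forall j, exists Tj : Omega -> Omega,
          (forall x, Y j x -> Tj x = T x) /\
          forall x y, closure (Y j) x -> closure (Y j) y ->
            tnorm N (Tj x - Tj y) <= eta * tnorm N (x - y)].

Definition invariant_measure (T : Omega -> Omega) (nu : probability Omega R) :=
  forall A, measurable A -> nu (T @^-1` A) = nu A.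

Definition mixing (T : Omega -> Omega) (nu : probability Omega R) :=
  forall A B, measurable A -> measurable B ->
    nu (A `&` iter n T @^-1` B) @[n --> \oo] --> (nu A * nu B)%E.

(* emb identifies the Banach space B with a linear subspace of L^oo(Leb),
   whose elements are functions up to Leb-a.e. equality *)
Definition included_in_Linfty (B : completeNormedModType R)
    (emb : B -> Omega -> R) : Prop :=
  [/\ forall h, emb h \in Lfun Leb +oo%E,
      forall (a : R) g h, {ae Leb, forall x, emb (a *: g + h) x = a * emb g x + emb h x} &
      forall h, {ae Leb, forall x, emb h x = 0} -> h = 0].

Definition decay_of_correlations (T : Omega -> Omega)
    (nu : probability Omega R) : Prop :=
  exists (B : completeNormedModType R) (emb : B -> Omega -> R) (C : R),
    included_in_Linfty emb /\
    forall (h : B) (f : Omega -> R) (m : nat), f \in Lfun nu 1 -> (1 <= m)%N ->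
      `| \int[nu]_x (f (iter m T x) * emb h x)
         - (\int[nu]_x f x) * (\int[nu]_x emb h x) |
      <= C * `|h| * fine ('N[nu]_1[EFin \o f])%E * m%:R ^- 2.

Definition equivalent_to_lebesgue (nu : probability Omega R) : Prop :=
  exists2 iota : R, 0 < iota & forall A, measurable A ->
    ((iota^-1)%:E * Leb A <= nu A)%E /\ (nu A <= iota%:E * Leb A)%E.

Definition bounded_density (nu : probability Omega R) : Prop :=
  exists2 phi : Omega -> R, phi \in Lfun Leb +oo%E &
    forall A, measurable A -> nu A = (\int[Leb]_(x in A) (phi x)%:E)%E.

Record assumption_M (T : Omega -> Omega) (nu : probability Omega R) : Prop := {
  M_measurable : measurable_fun setT T ;
  M_lipschitz : piecewise_lipschitz T ;
  M_invariant : invariant_measure T nu ;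
  M_mixing : mixing T nu ;
  M_decay : decay_of_correlations T nu ;
  M_equivalent : equivalent_to_lebesgue nu ;
  M_density : bounded_density nu
}.

Definition noise_ball : set 'rV[R]_d := [set v | N v <= 1].

(* rho only matters on the unit ball; its nonnegativity a.e. there, and that of
   rho1, follow from the formulas for theta *)
Definition assumption_N (theta : probability (noise N) R) : Prop :=
  exists (rho : 'rV[R]_d -> R) (rho1 : R -> R),
    [/\ rho \in Lfun (@lebesgue_rV R d) +oo%E,
        (\int[@lebesgue_rV R d]_(v in noise_ball) (rho v)%:E)%E = 1%E &
        forall A : set 'rV[R]_d, measurable A ->
          theta (@noise_val R d N @^-1` A)
          = (\int[@lebesgue_rV R d]_(v in A `&` noise_ball) (rho v)%:E)%E] /\
    [/\ measurable_fun setT rho1,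
        forall (i : 'I_d) (B : set (measurableTypeR R)), measurable B ->
          theta [set s | B (noise_val s ord0 i)]
          = (\int[lebesgue_measure]_(x in B) (rho1 x)%:E)%E,
        forall B : 'I_d -> set (measurableTypeR R), (forall i, measurable (B i)) ->
          theta [set s | forall i, B i (noise_val s ord0 i)]
          = (\prod_(i < d) theta [set s | B i (noise_val s ord0 i)])%E &
        {ae @lebesgue_rV R d, forall v, noise_ball v ->
          rho v = \prod_(i < d) rho1 (v ord0 i)}].

(* extended real-valued: the value is +oo when T^m x + eps xi_m = z *)
Definition noisy_process (T : Omega -> Omega) (eps : R) (z : Omega) (m : nat)
    (w : Omega * seq_space (noise N)) : \bar R :=
  (- lne (tnorm N (iter m T w.1 + to_torus (eps *: noise_val (w.2 m)) - z)%R)%:E)%E.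

End assumptions.

Section extreme_value_conditions.
Variables (R : realType) (disp : measure_display) (W : measurableType disp).
Variables (P : probability W R) (X : nat -> W -> \bar R).

Definition prob (A : set W) : R := fine (P A).

(* max {X_t, ..., X_(t+l-1)}; equal to -oo when l = 0 *)
Definition block_max (t l : nat) (w : W) : \bar R :=
  (\big[maxe/-oo]_(t <= i < t + l) X i w)%E.

Definition exceeds (j : nat) (u : R) : set W := [set w | (u%:E < X j w)%E].

Definition block_below (t l : nat) (u : R) : set W :=
  [set w | (block_max t l w <= u%:E)%E].

(* the sequence t_ is a parameter because condition_D' refers to it *)
Definition condition_D2 (u : nat -> R) (t_ : nat -> nat) : Prop :=
  exists gamma : nat -> nat -> R,
    [/\ forall l t m : nat,
          `| prob (exceeds 0 (u m) `&` block_below t l (u m))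
             - prob (exceeds 0 (u m)) * prob (block_below 0 l (u m)) |
          <= gamma m t,
        forall m, {homo gamma m : t t' / (t <= t')%N >-> t' <= t},
        (t_ m)%:R / m%:R @[m --> \oo] --> (0 : R) &
        m%:R * gamma m (t_ m) @[m --> \oo] --> (0 : R)].

Definition condition_D' (u : nat -> R) (t_ : nat -> nat) : Prop :=
  exists k : nat -> nat,
    [/\ k m @[m --> \oo] --> \oo,
        (k m * t_ m)%:R / m%:R @[m --> \oo] --> (0 : R) &
        m%:R * (\sum_(1 <= j < (m %/ k m).+1)
          prob (exceeds 0 (u m) `&` exceeds j (u m))) @[m --> \oo] --> (0 : R)].

End extreme_value_conditions.

(* Main.v *)
(* The rate G x = P (X_0 > u | x) is the probability that z - eps xi falls in the ball of radius
   r = exp (- u) around x.  The law of z - eps xi and nu both being comparable to Lebesgue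
   measure, G <= C p with p = P (X_0 > u) = int G dnu.  Given x the exceedances are independent,
   so P (X_0 > u, X_j > u) = int G (G o T^j) dnu <= C p^2, whence D'.

   For D_2 with t >= 1 the first probability is int G (F_l o T^t) dnu, where
   F_l = prod_(i < l) (1 - G o T^i), so it is enough that F_l be nearly constant in L^1, uniformly
   in l.  Since G / Leb (ball r) converges in L^1 to the density k of the law of z - eps xi, the
   ergodic theorem for simple functions approximating k (a variance estimate from mixing) makes
   S_l = sum_(i < l) G o T^i close to l p for l = O(1/p), and then F_l is close to exp (- l p);
   for longer blocks F_l is close to 0 by monotonicity.  One can take t_m = 1. *)
From HB Require Import structures.
Require Import Defs.
From mathcomp Require Import all_boot all_order all_algebra.
From mathcomp Require Import generic_quotient ring_quotient.
From mathcomp Require Import all_classical all_reals all_analysis.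
From mathcomp Require Import measurable_realfun ess_sup_inf ring lra zify.
Import Order.TTheory GRing.Theory Num.Theory.
Import numFieldNormedType.Exports.

Set Implicit Arguments.
Unset Strict Implicit.
Unset Printing Implicit Defensive.

Local Open Scope classical_set_scope.
Local Open Scope ring_scope.

(** Near constancy of [F_l] suffices because a constant [c] drops out of the covariance with [G]; by
    invariance of [nu], what remains is at most [sup G + p] times the L^1 norm of [F_l - c]. This
    bound does not involve the gap [t], which is why [t_m = 1] serves; at [t = 0] the same noise
    vector would enter both events.

    The obstacle is that [G] changes with the level while the relevant blocks have length of order
    [1 / p], so the ergodic sums tolerate only an L^1 error [o(p)] per term. Hence [G] is
    approximated by [b_m g], where the scalar [b_m] is the volume of the ball and the simple
    function [g] does not depend on [m]: a single ergodic threshold then serves all levels.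
    Closeness of [G / b_m] to [g] rests on measurable sets being almost invariant, in measure, under
    small translations.

    As [eps] is arbitrary, the noise may wrap around the torus several times; its law there is
    bounded by counting the sheets. *)

(** * Affine maps, circle rotations and fractional parts on the line *)

Section line_maps.
Variable R : realType.
Local Notation MR := (measurableTypeR R).
Local Notation lam := (@lebesgue_measure R).
Local Open Scope ereal_scope.

Lemma measurable_affine (a s : R) :
  measurable_fun setT ((fun w => a + s * w)%R : MR -> MR).
Proof. by apply: measurable_funD => //; apply: measurable_funM. Qed.

(** The pushforward scaled by [s] agrees with [lam] on half-open intervals, so uniqueness of
    Lebesgue measure identifies the two. *)
Lemma lebesgue_affine (a s : R) (A : set MR) : (0 < s)%R -> measurable A ->
  lam [set w | A (a + s * w)%R] = (s^-1)%:E * lam A.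
Proof.
move=> s0 mA.
have f_meas : measurable_fun setT ((fun w => a + s * w)%R : MR -> MR).
  exact: measurable_affine.
pose mu := mscale (NngNum (ltW s0)) (pushforward lam ((fun w => a + s * w)%R : MR -> MR)).
have itvE (x y : R) : lam [set` `]x, y]%R] =
    s%:E * lam ((fun w : MR => a + s * w)%R @^-1` [set` `]x, y]%R]).
  have -> : (fun w : MR => a + s * w)%R @^-1` [set` `]x, y]%R] =
      [set` `]((x - a) / s)%R, ((y - a) / s)%R]%R].
    apply/seteqP; split=> w /=; rewrite !in_itv /= ltr_pdivrMr// ler_pdivlMr//;
      by rewrite ltrBlDl lerBrDl mulrC.
  rewrite !lebesgue_measure_itv/= !lte_fin ltr_pM2r ?invr_gt0// ltrD2r.
  case: ifP => xy; last by rewrite mule0.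
  rewrite !EFinN -!EFinB -EFinM; congr EFin; field; exact: lt0r_neq0.
have muE : lam A = s%:E * lam ((fun w : MR => a + s * w)%R @^-1` A).
  transitivity (mu f_meas A); last by [].
  by apply: lebesgue_measure_unique => // _ [[x y] _ <-]; exact: itvE.
rewrite muE muleA -EFinM mulVf ?mul1e//.
exact: lt0r_neq0.
Qed.

Lemma lebesgue_affineN (a s : R) (A : set MR) : (0 < s)%R -> measurable A ->
  lam [set w | A (a - s * w)%R] = (s^-1)%:E * lam A.
Proof.
move=> s0 mA; rewrite -(lebesgue_affine a s0 mA) -[RHS]lebesgue_measureN.
  by rewrite /pushforward; congr (lam _); apply/seteqP; split => w /=; rewrite mulrN.
by rewrite -[X in measurable X]setTI; exact: (measurable_affine a s).
Qed.

(* w |-> w + a on the circle [0, 1[ *)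
Definition circle_add (a w : R) : R := if (w < 1 - a)%R then (w + a)%R else (w + a - 1)%R.

Lemma measurable_circle_add a : measurable_fun setT (circle_add a : MR -> MR).
Proof.
apply: measurable_fun_ifT => /=.
- exact: measurable_fun_ltr.
- by apply: measurable_funD.
- by apply: measurable_funB => //; apply: measurable_funD.
Qed.

(** The rotation carries [[0, 1 - a[] into [[a, 1[] and the rest into [[0, a[], each time by a
    translation, and these targets are disjoint. An inequality is enough here: the opposite rotation
    gives the converse on the torus. *)
Lemma lebesgue_circle_add_le a (A : set MR) : (0 <= a <= 1)%R -> measurable A ->
  lam ([set` `[0%R, 1%R[%R] `&` circle_add a @^-1` A) <= lam A.
Proof.
move=> /andP[a0 a1] mA.
pose A1 := A `&` [set` `[a, 1%R[%R]; pose A0 := A `&` [set` `[0%R, a[%R].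
have mA1 : measurable A1 by apply: measurableI => //; exact: measurable_itv.
have mA0 : measurable A0 by apply: measurableI => //; exact: measurable_itv.
have mB1 : measurable [set w : MR | A1 (a + 1 * w)%R].
  by rewrite -[X in measurable X]setTI; exact: (measurable_affine a 1).
have mB0 : measurable [set w : MR | A0 ((a - 1) + 1 * w)%R].
  by rewrite -[X in measurable X]setTI; exact: (measurable_affine (a - 1) 1).
apply: (@le_trans _ _ (lam ([set w | A1 (a + 1 * w)%R] `|`
    [set w | A0 ((a - 1) + 1 * w)%R]))).
  apply: le_measure; rewrite ?inE.
  - apply: measurableI; first exact: measurable_itv.
    by rewrite -[X in measurable X]setTI; exact: measurable_circle_add.
  - exact: measurableU.
  - move=> w [] /=; rewrite in_itv /= => /andP[w0 w1]; rewrite /circle_add !mul1r.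
    case: ifPn => wa Aw; [left|right]; split.
    + rewrite addrC; exact: Aw.
    + by rewrite /= in_itv /=; apply/andP; split; lra.
    + by rewrite addrAC (addrC a); exact: Aw.
    + by move: wa; rewrite -leNgt /= in_itv /= => wa; apply/andP; split; lra.
apply: (@le_trans _ _ (lam [set w | A1 (a + 1 * w)%R] + lam [set w | A0 ((a - 1) + 1 * w)%R])).
  exact: measureU2.
rewrite !lebesgue_affine// invr1 !mul1e -measureU//; last first.
  by apply/seteqP; split=> // w [[_ /=]]; rewrite in_itv /= => /andP[aw _] [_ /=];
    rewrite in_itv /= => /andP[_]; rewrite ltNge aw.
apply: le_measure; rewrite ?inE//; first exact: measurableU.
by move=> w [[]|[]].
Qed.

Lemma sume_const (n : nat) (x : \bar R) : 0 <= x -> \sum_(i < n) x = n%:R%:E * x.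
Proof.
move=> x0; elim: n => [|n IH]; first by rewrite big_ord0 mul0e.
by rewrite big_ord_recr /= IH -natr1 EFinD ge0_muleDl ?lee_fin// mul1e.
Qed.

Lemma measurable_affine_ball (a s r : R) : measurable [set w : MR | (`|a - s * w| < r)%R].
Proof.
have mf := measurable_affine a (- s).
have mlt := measurable_fun_ltr (measurableT_comp (@normr_measurable R setT) mf)
  (@measurable_cst _ _ _ _ setT r).
move: (mlt measurableT [set true] Logic.I); rewrite setTI.
by congr measurable; apply/funext => w /=; rewrite mulNr; apply/propext; split.
Qed.

Definition fpart (x : R) : R := (x - (Num.floor x)%:~R)%R.

Lemma fpart_itv x : (0 <= fpart x < 1)%R.
Proof.
rewrite /fpart; have /andP[] := Num.Theory.floor_itv x.
by rewrite intrD => *; apply/andP; split; lra.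
Qed.

Lemma measurable_fpart : measurable_fun setT (fpart : MR -> MR).
Proof.
apply: measurable_funB => //.
apply: nondecreasing_measurable => // x y xy.
by rewrite ler_int Num.Theory.le_floor.
Qed.

Lemma measurable_fpart_affine (a s : R) :
  measurable_fun setT ((fun w => fpart (a - s * w)%R) : MR -> MR).
Proof.
have -> : (fun w : MR => fpart (a - s * w)) = fpart \o (fun w : MR => a + (- s) * w)%R.
  by apply/funext => w /=; rewrite mulNr.
by apply: measurableT_comp => //; [exact: measurable_fpart|exact: measurable_affine].
Qed.

(** Where [a - s * w] has modulus below [n], its integer part takes at most [n.*2.+1] values, and
    each value contributes an affine preimage of measure [lam A / s]. *)
Lemma lebesgue_fpart_le (a s : R) (n : nat) (A : set MR) : (0 < s)%R -> measurable A ->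
  lam ([set w | `|(a - s * w)%R| < n%:R]%R `&` (fun w => fpart (a - s * w)%R) @^-1` A)
    <= ((n.*2.+1)%:R / s)%:E * lam A.
Proof.
move=> s0 mA; pose c (i : nat) := (a + n%:R - i%:R)%R.
have mB i : measurable [set w : MR | A (c i - s * w)%R].
  rewrite -[X in measurable X]setTI.
  have -> : (fun w : MR => A (c i - s * w)%R) = (fun w : MR => c i + (- s) * w)%R @^-1` A.
    by apply/funext => w /=; rewrite mulNr.
  exact: (measurable_affine (c i) (- s)).
apply: (@le_trans _ _ (lam (\big[setU/set0]_(i < n.*2.+1) [set w | A (c i - s * w)%R]))).
  apply: le_measure; rewrite ?inE.
  - apply: measurableI; first exact: measurable_affine_ball.
    by rewrite -[X in measurable X]setTI; exact: measurable_fpart_affine.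
  - by apply: bigsetU_measurable => i _; exact: mB.
  - move=> w [/= wn]; rewrite /fpart => Aw.
    set x := (a - s * w)%R in wn Aw; have := Num.Theory.floor_itv x.
    move: wn; rewrite ltr_norml => /andP[x1 x2] /andP[x3 x4].
    (* Adding [n] turns the integer part into an index between [0] and [n.*2]. *)
    pose k := (Num.floor x + n%:Z)%R.
    have k0 : (0 <= k)%R.
      have : (- n%:Z < Num.floor x + 1)%R.
        by rewrite -(ltr_int R) mulrNz; exact: lt_trans x4.
      rewrite /k; lia.
    have kn : (k < n.*2.+1%:Z)%R.
      have : (Num.floor x < n%:Z)%R by rewrite -(ltr_int R); exact: le_lt_trans x2.
      rewrite /k; lia.
    have kE : k = `|k|%N%:Z by rewrite gez0_abs.
    have kn' : (`|k| < n.*2.+1)%N by rewrite -ltz_nat -kE.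
    rewrite -(bigcup_mkord _ (fun i => [set w : MR | A (c i - s * w)%R])); exists `|k|%N => //=.
    suff -> : (c `|k|%N - s * w = x - (Num.floor x)%:~R)%R by [].
    rewrite /c (_ : `|k|%N%:R = k%:~R); last by rewrite [in RHS]kE.
    by rewrite /k intrD /x; ring.
apply: (@le_trans _ _ (\sum_(i < n.*2.+1) lam [set w : MR | A (c i - s * w)%R])).
  by apply: (Boole_inequality _ (A := fun i => [set w : MR | A (c i - s * w)%R])) => i _.
rewrite (eq_bigr (fun=> (s^-1)%:E * lam A)); last by move=> i _; rewrite lebesgue_affineN.
by rewrite sume_const ?EFinM ?muleA// mule_ge0// lee_fin invr_ge0 ltW.
Qed.
End line_maps.

(** The assumption on sets says that the image under [f] of [m1] restricted to [D] is dominated by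
    [c] times [m2]; integrals of nonnegative functions inherit the domination. *)
Lemma ge0_integral_le_map d1 d2 (X : measurableType d1) (Y : measurableType d2)
    (R : realType) (m1 : {measure set X -> \bar R}) (m2 : {measure set Y -> \bar R})
    (D : set X) (f : X -> Y) (c : R) (h : Y -> \bar R) :
  (0 <= c)%R -> measurable D -> measurable_fun setT f ->
  (forall A, measurable A -> m1 (D `&` f @^-1` A) <= c%:E * m2 A)%E ->
  measurable_fun setT h -> (forall x, 0 <= h x)%E ->
  (\int[m1]_(x in D) h (f x) <= c%:E * \int[m2]_x h x)%E.
Proof.
move=> c0 mD mf H mh h0; pose c' := NngNum c0.
rewrite -(ge0_integral_mscale m2 measurableT c' mh) => [|//].
rewrite -(@eq_measure_integral _ _ _ D m1 (mrestr m1 mD)); last first.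
  by move=> A _ AD; rewrite /mrestr; congr (m1 _); exact/setIidPl.
apply: (@le_trans _ _ (\int[mrestr m1 mD]_x h (f x))%E).
  by apply: ge0_subset_integral => //; exact: measurableT_comp.
rewrite -[X in integral _ X _]/(f @^-1` setT) -ge0_integral_pushforward//.
apply: ge0_le_measure_integral => //= A mA.
by rewrite /mscale/= /pushforward/= /mrestr setIC; exact: H.
Qed.

(** * Coordinatewise maps and product Lebesgue measure *)

Section product_maps.
Variable R : realType.
Local Notation MR := (measurableTypeR R).
Local Notation lam := (@lebesgue_measure R).
Local Open Scope ereal_scope.

Definition tuple_map n (f : 'I_n -> R -> R) (t : n.-tuple MR) : n.-tuple MR :=
  [tuple f i (tnth t i) | i < n].

Lemma measurable_tuple_map n (f : 'I_n -> R -> R) :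
  (forall i, measurable_fun setT (f i : MR -> MR)) ->
  measurable_fun setT (tuple_map f).
Proof.
move=> mf; apply/measurable_fun_tnthP => i.
rewrite (_ : _ \o _ = f i \o (@tnth n R)^~ i); last by apply/funext => t /=; rewrite tnth_mktuple.
by apply: measurableT_comp; [exact: mf|exact: (@measurable_tnth _ MR)].
Qed.

Lemma measurable_tuple_box n (D : 'I_n -> set MR) :
  (forall i, measurable (D i)) -> measurable [set t : n.-tuple MR | forall i, D i (tnth t i)].
Proof.
move=> mD.
have -> : [set t : n.-tuple MR | forall i, D i (tnth t i)] =
    \bigcap_(i in [set: 'I_n]) ((fun t : n.-tuple MR => tnth t i) @^-1` D i).
  by apply/seteqP; split=> t /= tD i => [_|]; [exact: tD|exact: (tD i Logic.I)].
apply: fin_bigcap_measurable => [|i _]; first exact: finite_finset.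
rewrite -[X in measurable X]setTI.
by apply: (@measurable_tnth _ MR) => //; exact: mD.
Qed.

Lemma tnth_consp n (p : MR * n.-tuple MR) (D : 'I_n.+1 -> set MR) :
  (forall i, D i (tnth (consp p) i)) <->
  D ord0 p.1 /\ forall i, D (lift ord0 i) (tnth p.2 i).
Proof.
split=> [H|[H0 H] i].
  by split=> [|i]; [exact: (H ord0)|have := H (lift ord0 i); rewrite tnthS].
by case: (unliftP ord0 i) => [j ->|-> //]; rewrite tnthS.
Qed.

Lemma tuple_map_consp n (f : 'I_n.+1 -> R -> R) (p : MR * n.-tuple MR) :
  tuple_map f (consp p) = consp (f ord0 p.1, tuple_map (fun i => f (lift ord0 i)) p.2).
Proof.
apply: eq_from_tnth => i; rewrite tnth_mktuple.
by case: (unliftP ord0 i) => [j ->|-> //]; rewrite !tnthS tnth_mktuple.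
Qed.

(** Induction on the dimension by slicing: the slice of the left-hand set over [x] lies in the set
    of the same form built from the slice of [A] over [f ord0 x]; the one-dimensional bound then
    controls the integral over [x]. *)
Lemma lebesgue_tuple_map_le n (f : 'I_n -> R -> R) (D : 'I_n -> set MR) (c : R)
    (A : set (n.-tuple MR)) : (0 <= c)%R ->
  (forall i, measurable_fun setT (f i : MR -> MR)) -> (forall i, measurable (D i)) ->
  (forall i B, measurable B -> lam (D i `&` f i @^-1` B) <= c%:E * lam B) ->
  measurable A ->
  lebesgue_tuple R n ([set t | forall i, D i (tnth t i)] `&` tuple_map f @^-1` A)
    <= (c ^+ n)%:E * lebesgue_tuple R n A.
Proof.
move=> c0; elim: n => [|n IH] in f D A *.
  (* In dimension zero the measure is a Dirac mass and the claim is an inclusion. *)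
  move=> mf mD H mA; rewrite expr0 mul1e /= /dirac /= !indicE lee_fin ler_nat.
  case: (boolP (_ \in A)) => tA; first by case: (_ \in _).
  rewrite [X in (nat_of_bool X <= _)%N](_ : _ = false)//; apply/negbTE.
  apply: contra tA; rewrite !inE => -[_] /=.
  by congr A; apply: eq_from_tnth => -[].
move=> mf mD H mA.
set E := _ `&` _.
have mE : measurable E.
  apply: measurableI; first exact: measurable_tuple_box.
  by rewrite -[X in measurable X]setTI; exact: measurable_tuple_map.
have mc (B : set (n.+1.-tuple MR)) : measurable B -> measurable (@consp R n @^-1` B).
  by move=> mB; rewrite -[X in measurable X]setTI; exact: consp_measurable.
pose m := lebesgue_tuple R n.
pose h (B : set (n.+1.-tuple MR)) x := m (xsection (@consp R n @^-1` B) x).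
(* The product measure is defined by integrating slices, so this holds by conversion. *)
have hE B : lebesgue_tuple R n.+1 B = \int[lam]_x h B x by [].
have h0 B x : 0 <= h B x by exact: measure_ge0.
have mh B : measurable B -> measurable_fun setT (h B).
  by move=> mB; apply: measurable_fun_xsection; exact: mc.
rewrite !hE exprS EFinM -muleA.
apply: (@le_trans _ _ (\int[lam]_(x in D ord0) ((c ^+ n)%:E * h A (f ord0 x)))).
  rewrite [leRHS]integral_mkcond; apply: ge0_le_integral => //.
  - exact: (mh _ mE).
  - apply/(measurable_restrictT _ _).1 => //.
    apply: measurable_funeM; apply: measurable_funTS.
    exact: (measurableT_comp (mh _ mA) (mf ord0)).
  - move=> x _; rewrite patchE; case: ifPn => [_|xD].
    + have mA' : measurable (xsection (@consp R n @^-1` A) (f ord0 x)).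
        by apply: measurable_xsection; exact: mc.
      apply: (le_trans _ (IH _ _ _ (fun i => mf (lift ord0 i))
        (fun i => mD (lift ord0 i)) (fun i => H (lift ord0 i)) mA')).
      apply: le_measure; rewrite ?inE.
      * by apply: measurable_xsection; exact: mc.
      * apply: measurableI; first exact: (measurable_tuple_box (fun i => mD (lift ord0 i))).
        rewrite -[X in measurable X]setTI.
        by apply: (measurable_tuple_map (fun i => mf (lift ord0 i))).
      * move=> t; rewrite /xsection /= inE /E /= => -[/tnth_consp[/= _ tD]].
        by rewrite tuple_map_consp /= => tA; split=> //=; rewrite inE.
    + rewrite /h (_ : xsection _ _ = set0) ?measure0//.
      apply/seteqP; split=> // t; rewrite /xsection /= inE /E /= => -[/tnth_consp[/= xD' _] _].
      by move: xD; rewrite notin_setE.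
rewrite ge0_integralZl_EFin ?exprn_ge0//; last first.
  by apply: measurable_funTS; exact: (measurableT_comp (mh _ mA) (mf ord0)).
rewrite muleCA lee_wpmul2l ?lee_fin ?exprn_ge0//.
exact: (ge0_integral_le_map c0 (mD ord0) (mf ord0) (H ord0) (mh _ mA) (h0 A)).
Qed.

Lemma lebesgue_tuple_cube n :
  lebesgue_tuple R n [set t | forall i, (0 <= tnth t i < 1)%R] = 1.
Proof.
elim: n => [|n IH].
  by rewrite /= /dirac /= indicE (_ : _ \in _) // inE => -[].
rewrite [LHS]/= /lebesgue_cons.
have -> : @consp R n @^-1` [set t | forall i, (0 <= tnth t i < 1)%R] =
   [set x : MR | (0 <= x < 1)%R] `*` [set t | forall i, (0 <= tnth t i < 1)%R].
  apply/seteqP; split=> p; rewrite /= => /(tnth_consp p (fun=> [set x : MR | (0 <= x < 1)%R])) //.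
have -> : [set x : MR | (0 <= x < 1)%R] = [set` `[0%R, 1%R[%R].
  by apply/seteqP; split=> x /=; rewrite in_itv.
rewrite product_measure1E//=.
- by rewrite IH lebesgue_measure_itv/= lte01 oppr0 adde0 mule1.
- apply: (@measurable_tuple_box n (fun=> [set x : MR | (0 <= x < 1)%R])) => i.
  have -> : [set x : MR | (0 <= x < 1)%R] = [set` `[0%R, 1%R[%R].
    by apply/seteqP; split=> x /=; rewrite in_itv.
  exact: measurable_itv.
Qed.

End product_maps.

(** * Norms on ['rV[R]_d] and their equivalence *)

Section vnorm_theory.
Variables (R : realType) (d : nat) (N : vnorm R d).

Lemma vnorm0 : N 0 = 0.
Proof. by rewrite -(scale0r 0) vnormZ normr0 mul0r. Qed.

Lemma vnormN v : N (- v) = N v.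
Proof. by rewrite -scaleN1r vnormZ normrN1 mul1r. Qed.

Lemma vnorm_ge0 v : 0 <= N v.
Proof.
have := vnormD N v (- v); rewrite subrr vnorm0 vnormN; lra.
Qed.

Lemma vnorm_gt0 v : v != 0 -> 0 < N v.
Proof.
move=> v0; rewrite lt_neqAle vnorm_ge0 andbT eq_sym.
by apply: contra v0 => /eqP /vnorm_eq0 ->.
Qed.

Lemma vnorm_sum (I : Type) (s : seq I) (F : I -> 'rV[R]_d) :
  N (\sum_(i <- s) F i) <= \sum_(i <- s) N (F i).
Proof.
elim: s => [|i s IH]; first by rewrite !big_nil vnorm0.
by rewrite !big_cons (le_trans (vnormD _ _ _))// lerD2l.
Qed.

Lemma coord_le_norm (v : 'rV[R]_d) i : `|v ord0 i| <= `|v|.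
Proof.
rewrite {2}/Num.norm /= mx_normrE.
exact: (le_bigmax _ (fun ij : 'I_1 * 'I_d => `|v ij.1 ij.2|) (ord0, i)).
Qed.

Lemma vnorm_le_norm : exists2 C : R, 0 < C & forall v, N v <= C * `|v|.
Proof.
(* The summand [1] keeps the constant positive even when [d = 0]. *)
exists (1 + \sum_i N (delta_mx ord0 i)).
  by rewrite ltr_pwDl// sumr_ge0// => i _; exact: vnorm_ge0.
move=> v; rewrite {1}(row_sum_delta v) (le_trans (vnorm_sum _ _))//.
rewrite mulrDl mul1r mulr_suml ler_wpDl// ler_sum// => i _.
by rewrite vnormZ mulrC ler_wpM2l ?vnorm_ge0// coord_le_norm.
Qed.

Lemma vnorm_sub_le u v : `|N u - N v| <= N (u - v).
Proof.
have := vnormD N (u - v) v; have := vnormD N (v - u) u.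
rewrite !subrK -(opprB u v) vnormN ler_norml => *; apply/andP; split; lra.
Qed.

Lemma vnorm_continuous : continuous N.
Proof.
have [C C0 NC] := vnorm_le_norm.
move=> v; apply/(@cvgrPdist_lt _ _ _ (nbhs v) (nbhs_filter v)) => e e0; apply/nbhs_ballP.
exists (e / C); first by rewrite /= divr_gt0.
rewrite mx_norm_ball => w /= vw; rewrite (le_lt_trans (vnorm_sub_le _ _))// (le_lt_trans (NC _))//.
by rewrite mulrC -ltr_pdivlMr.
Qed.

End vnorm_theory.

(** The supremum norm packaged as a [vnorm]: it gives access to the general continuity lemma, and
    serves as auxiliary norm for statements that mention none. *)
Definition mx_vnorm (R : realType) (d : nat) : vnorm R d :=
  VNorm (@ler_normD R 'rV[R]_d) (@mx_normZ R 1 d) (fun v => @normr0_eq0 R 'rV[R]_d v).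

Section vnorm_equivalence.
Variables (R : realType) (d : nat) (N : vnorm R d).

(** The continuous function [N] attains a minimum on the compact unit sphere of the supremum norm;
    this minimum is positive and its inverse is the constant. *)
Lemma norm_le_vnorm : exists2 C : R, 0 < C & forall v, `|v| <= C * N v.
Proof.
(* In the zero space the sphere is empty and has no minimiser. *)
case: (pselect (exists v : 'rV[R]_d, v != 0)) => [[v0 v00]|H]; last first.
  exists 1 => // v; case: (eqVneq v 0) => [->|v0]; first by rewrite normr0 vnorm0 mulr0.
  by case: H; exists v.
pose S := [set v : 'rV[R]_d | `|v| = 1].
have S0 : S !=set0.
  by exists (`|v0|^-1 *: v0); rewrite /S /= normrZ normfV normr_id mulVf// normr_eq0.
have cS : compact S.
  apply: bounded_closed_compact.
    by exists 1; split => // x x1 v /= ->; exact: ltW.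
  rewrite (_ : S = (mx_vnorm R d : 'rV[R]_d -> R) @^-1` [set 1 : R])//.
  apply: preimage_closed => [v _|]; last exact/accessible_closed_set1/hausdorff_accessible/Rhausdorff.
  exact: (@vnorm_continuous _ _ (mx_vnorm R d)).
have [c /= Sc cmin] := EVT_min_rV S0 cS (continuous_subspaceT (@vnorm_continuous _ _ N)).
have Nc0 : 0 < N c.
  apply: vnorm_gt0; apply/eqP => c0; move: Sc; rewrite inE /S /= c0 normr0 => /eqP.
  by rewrite eq_sym oner_eq0.
exists (N c)^-1; first by rewrite invr_gt0.
move=> v; case: (eqVneq v 0) => [->|vn0]; first by rewrite normr0 vnorm0 mulr0.
have vgt0 : 0 < `|v| by rewrite normr_gt0.
have := cmin (`|v|^-1 *: v); rewrite inE /S /= normrZ normfV normr_id mulVf ?gt_eqF//.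
move=> /(_ erefl); rewrite vnormZ normfV normr_id.
by rewrite ler_pdivlMl// ler_pdivlMl// mulrC.
Qed.

Lemma measurable_noise_ball : measurable (@noise_ball R d N).
Proof.
rewrite (_ : noise_ball N = ~` [set v | 1 < N v]); last first.
  by apply/seteqP; split=> v /=; rewrite /noise_ball /= leNgt => /negP.
apply: measurableC; apply: open_measurable_rV.
rewrite (_ : [set v | 1 < N v] = N @^-1` `]1, +oo[%classic); last first.
  by apply/seteqP; split=> v /=; rewrite in_itv /= andbT.
by have /continuousP := @vnorm_continuous _ _ N; apply; exact: interval_open.
Qed.

End vnorm_equivalence.

Lemma row_affine_continuous (R : realType) (d : nat) (a : 'rV[R]_d) (s : R) :
  continuous (fun v : 'rV[R]_d => a + s *: v).
Proof.
move=> v U /nbhs_ballP[e /= e0]; rewrite mx_norm_ball => eU.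
have s1 : 0 < `|s| + 1 by rewrite ltr_wpDl.
apply/nbhs_ballP; exists (e / (`|s| + 1)); first exact: divr_gt0.
rewrite mx_norm_ball => w /= vw; apply: eU => /=.
rewrite opprD addrACA subrr add0r -scalerBr mx_normZ.
apply: (@le_lt_trans _ _ ((`|s| + 1) * `|v - w|)); first by rewrite ler_wpM2r// lerDl.
by rewrite mulrC -ltr_pdivlMr.
Qed.

Lemma row_add_continuous (R : realType) (d : nat) (v : 'rV[R]_d) : continuous (+%R v).
Proof.
rewrite (_ : +%R v = fun w => v + 1 *: w); first exact: row_affine_continuous.
by apply/funext => w; rewrite scale1r.
Qed.

Lemma row_opp_continuous (R : realType) (d : nat) : continuous (-%R : 'rV[R]_d -> 'rV[R]_d).
Proof.
rewrite (_ : -%R = fun w : 'rV[R]_d => 0 + (-1) *: w); first exact: row_affine_continuous.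
by apply/funext => w; rewrite add0r scaleN1r.
Qed.

(** * The torus: balls, topology and measurable group operations *)

Section torus_theory.
Variables (R : realType) (d : nat) (N : vnorm R d).
Local Notation Omega := (torus R d).

Lemma to_torusB (u v : 'rV[R]_d) : to_torus (u - v) = to_torus u - to_torus v.
Proof. exact: (raddfB (\pi_(torus R d)%qT)). Qed.

Lemma to_torus0 : to_torus 0 = 0 :> Omega.
Proof. by rewrite -[X in to_torus X](subrr 0) to_torusB subrr. Qed.

Lemma to_torusN (v : 'rV[R]_d) : to_torus (- v) = - to_torus v.
Proof. by rewrite -sub0r to_torusB to_torus0 sub0r. Qed.

Lemma to_torusD (u v : 'rV[R]_d) : to_torus (u + v) = to_torus u + to_torus v.
Proof. by rewrite -{1}(opprK v) to_torusB to_torusN opprK. Qed.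

Lemma to_torus_surj (x : Omega) : exists v, to_torus v = x.
Proof. by exists (repr x); rewrite /to_torus reprK. Qed.

Lemma to_torus_eq (u v : 'rV[R]_d) :
  (forall i, u ord0 i - v ord0 i \is a Num.int) -> to_torus u = to_torus v.
Proof.
move=> H; apply/eqP; rewrite /to_torus -Quotient.idealrBE.
by apply/forallP => i; rewrite !mxE.
Qed.

Definition tball (r : R) : set Omega := [set x | tnorm N x < r].

(** A strict bound on the infimum in [tnorm] is witnessed by one lift, so symmetry and the triangle
    inequality descend from [N] without the infimum having to be attained. *)
Lemma tballP r x : tball r x <-> exists w, to_torus w = x /\ N w < r.
Proof.
have H : has_inf (N @` [set v | to_torus v = x]).
  split; first by have [v vx] := to_torus_surj x; exists (N v); exists v.
  by exists 0 => _ [v _ <-]; exact: vnorm_ge0.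
split=> [|[w [wx wr]]].
  by rewrite /tball /= /tnorm => /(inf_lt H.1) [_ [w /= wx <-] wr]; exists w.
apply: le_lt_trans wr; apply: ge_inf; first exact: H.2.
by exists w.
Qed.

Lemma tball_opp r x : tball r (- x) <-> tball r x.
Proof.
by split=> /tballP[w [wx wr]]; apply/tballP; exists (- w);
  rewrite to_torusN wx vnormN ?opprK.
Qed.

Lemma tballD r s x y : tball r x -> tball s y -> tball (r + s) (x + y).
Proof.
move=> /tballP[v [<- vr]] /tballP[w [<- ws]]; apply/tballP; exists (v + w).
by rewrite to_torusD; split=> //; rewrite (le_lt_trans (vnormD _ _ _))// ltrD.
Qed.

Lemma tball_subset r s : r <= s -> tball r `<=` tball s.
Proof. by move=> rs x /= xr; exact: lt_le_trans xr rs. Qed.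

Lemma open_torusE (U : set Omega) : open U = open (@to_torus R d @^-1` U).
Proof. by []. Qed.

Lemma open_shift (a : Omega) (U : set Omega) : open U -> open [set x | U (a + x)].
Proof.
rewrite !open_torusE => oU; have [v va] := to_torus_surj a.
rewrite (_ : _ @^-1` _ = (+%R v) @^-1` (@to_torus R d @^-1` U)); last first.
  by apply/seteqP; split=> w /=; rewrite to_torusD va.
have /continuousP H : continuous (+%R v : 'rV[R]_d -> 'rV[R]_d) by exact: row_add_continuous.
exact: H.
Qed.

Lemma open_tball r : open (tball r).
Proof.
have -> : tball r = @to_torus R d @` [set w | N w < r].
  by apply/seteqP; split=> x => [/tballP[w [wx wr]]|[w wr wx]]; [exists w|apply/tballP; exists w].
rewrite open_torusE.
have oB : open [set w | N w < r].
  rewrite (_ : [set w | N w < r] = N @^-1` `]-oo, r[%classic); last first.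
    by apply/seteqP; split=> v /=; rewrite in_itv.
  by have /continuousP := @vnorm_continuous _ _ N; apply; exact: interval_open.
(* The preimage of the projected ball is the union of its lattice translates. *)
rewrite (_ : _ @^-1` _ = \bigcup_(u in [set u | to_torus u = 0 :> Omega])
    ((+%R u) @^-1` [set w | N w < r])).
  apply: bigcup_open => u _.
  have /continuousP H : continuous (+%R u : 'rV[R]_d -> 'rV[R]_d) by exact: row_add_continuous.
  exact: H.
apply/seteqP; split=> [v [w /= wr wv]|v [u /= u0 ur]].
  exists (w - v) => /=; last by rewrite subrK.
  by rewrite to_torusB wv /to_torus subrr.
by exists (u + v) => //; rewrite to_torusD u0 add0r.
Qed.

Lemma tball_nbhs (U : set Omega) x : open U -> U x ->
  exists2 r, 0 < r & forall v, tball r v -> U (x + v).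
Proof.
move=> oU Ux; have [v vx] := to_torus_surj x.
have [C C0 NC] := norm_le_vnorm N.
have : nbhs v (@to_torus R d @^-1` U).
  by apply: open_nbhs_nbhs; split; [exact: oU|rewrite /= vx].
  move=> /nbhs_ballP[e /= e0]; rewrite mx_norm_ball => eU.
exists (e / C); first exact: divr_gt0.
move=> _ /tballP[w [<- wr]]; rewrite -vx -to_torusD.
apply: eU; rewrite /ball_ /= opprD addNKr normrN (le_lt_trans (NC _))//.
by rewrite mulrC -ltr_pdivlMr.
Qed.

Lemma open_measurable_torus (U : set Omega) : open U -> measurable U.
Proof. exact: sub_sigma_algebra. Qed.

Lemma measurable_tball r : measurable (tball r).
Proof. by apply: open_measurable_torus; exact: open_tball. Qed.

Lemma measurable_torus_fun d' (X : measurableType d') (f : X -> Omega) :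
  (forall U, open U -> measurable (f @^-1` U)) -> measurable_fun setT f.
Proof.
by move=> H; apply: (measurability (@open Omega)) => // _ [U oU <-]; rewrite setTI; exact: H.
Qed.

Lemma torus_preimage_measurable d' (X : measurableType d') (f : X -> Omega) A :
  measurable_fun setT f -> measurable A -> measurable (f @^-1` A).
Proof. by move=> mf mA; rewrite -[X in measurable X]setTI; exact: mf. Qed.

Lemma measurable_shift (a : Omega) : measurable_fun setT (+%R a : Omega -> Omega).
Proof.
apply: measurable_torus_fun => U oU; apply: open_measurable_torus.
exact: open_shift.
Qed.

Lemma measurable_torus_opp : measurable_fun setT (-%R : Omega -> Omega).
Proof.
apply: measurable_torus_fun => U oU; apply: open_measurable_torus.
move: oU; rewrite !open_torusE => oU.
rewrite (_ : _ @^-1` _ = -%R @^-1` (@to_torus R d @^-1` U)); last first.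
  by apply/seteqP; split=> w /=; rewrite to_torusN.
have /continuousP H : continuous (-%R : 'rV[R]_d -> 'rV[R]_d) by exact: row_opp_continuous.
exact: H.
Qed.

Definition rat_point (q : 'rV[rat]_d) : Omega := to_torus (map_mx ratr q).

Lemma rat_point_dense x r : 0 < r -> exists q, tball r (x - rat_point q).
Proof.
move=> r0; have [v <-] := to_torus_surj x.
have [C C0 NC] := vnorm_le_norm N.
have qP i : exists q : rat, `|v ord0 i - ratr q| < r / C.
  have rC : 0 < r / C by exact: divr_gt0.
  have [|q] := @rat_in_itvoo R (v ord0 i - r / C) (v ord0 i + r / C).
    by rewrite ltrD2l gtrN.
  by rewrite in_itv /= => qi; exists q; rewrite distrC ltr_distl.
have [q qE] := choice qP.
exists (\row_i q i); apply/tballP; exists (v - map_mx ratr (\row_i q i)).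
split; first by rewrite to_torusB.
rewrite (le_lt_trans (NC _))// mulrC -ltr_pdivlMr//.
rewrite /Num.norm /= mx_normrE; apply/bigmax_ltP; split; first exact: divr_gt0.
by move=> [i j] _ /=; rewrite ord1 !mxE.
Qed.

(** The sigma-algebra on pairs is the product of the Borel ones, so open preimages must be exhibited
    as countable unions of rectangles: products of small balls with rational centres. *)
Lemma measurable_torus_sub :
  measurable_fun setT (fun p : Omega * Omega => p.1 - p.2).
Proof.
apply: measurable_torus_fun => U oU.
pose r_ n : R := n.+1%:R^-1.
(* A rectangle is kept only if all its differences fall in [U]; other indices contribute the empty
   set. *)
pose F (s : 'rV[rat]_d * 'rV[rat]_d * nat) : set (Omega * Omega) :=
  let: (q, q', n) := s in
  if pselect (forall v w, tball (r_ n) v -> tball (r_ n) w ->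
    U (rat_point q + v - (rat_point q' + w)))
  then [set x | tball (r_ n) (- rat_point q + x)] `*` [set x | tball (r_ n) (- rat_point q' + x)]
  else set0.
rewrite (_ : _ @^-1` _ = \bigcup_s F s).
  apply: countable_bigcupT_measurable => [|s]; first exact: countableP.
  case: s => -[q q'] n; rewrite /F; case: pselect => [?|?] /=; last exact: measurable0.
  by apply: measurableX; apply: open_measurable_torus;
    apply: (@open_shift (- rat_point _) (tball _)); exact: open_tball.
apply/seteqP; split=> [[x y] /= Uxy|[x y] [[[q q'] n] _]]; last first.
  rewrite /F; case: pselect => [H|?] /= []/= xq yq.
  by have := H _ _ xq yq; rewrite !addNKr.
have [e e0 eU] := tball_nbhs oU Uxy.
have [n _ nN] := near_infty_natSinv_lt (PosNum (divr_gt0 e0 (ltr0n R 4))).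
(* Within the rectangle around [(x, y)] the difference moves by [(v - w) - (a - b)], made of four
   vectors of length below [r_ n]. *)
have rn : r_ n + r_ n + r_ n + r_ n < e.
  by have := nN n (leqnn n); rewrite /= -/(r_ n); lra.
have rn0 : 0 < r_ n by rewrite invr_gt0.
have [q xq] := rat_point_dense x rn0; have [q' yq] := rat_point_dense y rn0.
exists (q, q', n) => //=; case: pselect => [?|[]]/=; last first.
  move=> v w vr wr.
  set a := x - rat_point q; set b := y - rat_point q'.
  have -> : rat_point q + v - (rat_point q' + w) = x - y + ((v - w) - (a - b)).
    have E (G : zmodType) (c c' e1 e2 v1 w1 : G) :
        c + v1 - (c' + w1) = (e1 + c) - (e2 + c') + ((v1 - w1) - (e1 - e2)).
      rewrite [e1 + c]addrC [e2 + c']addrC (opprD c' w1) (opprD c' e2) (addrACA c v1) (addrACA c e1).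
      by rewrite -[RHS]addrA; congr (_ + _); rewrite [RHS]addrC subrK.
    by rewrite (E _ _ _ a b) !subrK.
  have {}rn : r_ n + r_ n + (r_ n + r_ n) <= e by rewrite ltW// addrA.
  apply: eU; apply: (tball_subset rn); apply: tballD.
    by apply: tballD => //; exact/tball_opp.
  by apply/tball_opp; apply: tballD => //; exact/tball_opp.
by split=> /=; rewrite addrC.
Qed.

End torus_theory.

(** * Haar measure on the torus *)

Section lebesgue_torus_theory.
Variables (R : realType) (d : nat).
Local Notation Omega := (torus R d).
Local Notation Leb := (@lebesgue_torus R d).
Local Notation MR := (measurableTypeR R).
Local Open Scope ereal_scope.

Lemma lebesgue_torusE (A : set Omega) : Leb A =
  lebesgue_tuple R d [set t : d.-tuple MR |
    (forall i, (0 <= tnth t i < 1)%R) /\ A (to_torus (tuple_row t))].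
Proof.
rewrite /lebesgue_torus /lebesgue_rV; congr (lebesgue_tuple R d _).
apply/seteqP; split=> t [tc tA]; split=> // i; first by have := tc i; rewrite mxE.
by rewrite mxE.
Qed.

Lemma measurable_torus_cube (A : set Omega) : measurable A ->
  measurable [set t : d.-tuple MR |
    (forall i, (0 <= tnth t i < 1)%R) /\ A (to_torus (tuple_row t))].
Proof.
move=> mA; apply: measurableI.
  apply: (@measurable_tuple_box R d (fun=> [set x : MR | (0 <= x < 1)%R])) => i.
  have -> : [set x : MR | (0 <= x < 1)%R] = [set` `[0%R, 1%R[%R].
    by apply/seteqP; split=> x /=; rewrite in_itv.
  exact: measurable_itv.
rewrite -[X in measurable X]setTI.
exact: (measurableT_comp (@measurable_to_torus R d) (@measurable_tuple_row R d)).
Qed.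

Lemma lebesgue_torusT : Leb setT = 1.
Proof.
rewrite lebesgue_torusE -[RHS](lebesgue_tuple_cube R d); congr (lebesgue_tuple R d _).
by apply/seteqP; split=> t => [[]|].
Qed.

HB.instance Definition _ := Measure_isProbability.Build _ _ _
  (@lebesgue_torus R d) lebesgue_torusT.

(** Read in the unit cube, a translation acts on each coordinate as [circle_add], so the
    coordinatewise estimate applies with factor [1]. *)
Lemma lebesgue_shift_le (a : Omega) A : measurable A -> Leb [set x | A (a + x)%R] <= Leb A.
Proof.
move=> mA; have [v va] := to_torus_surj a.
pose f (i : 'I_d) := circle_add (fpart (v ord0 i)).
have fI i : (0 <= fpart (v ord0 i) <= 1)%R.
  by have /andP[-> /ltW ->] := fpart_itv (v ord0 i).
pose D (i : 'I_d) := [set` `[0%R, 1%R[%R] : set MR.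
have := lebesgue_tuple_map_le (c := 1) (f := f) (D := D) ler01
  (fun i => measurable_circle_add _) (fun i => measurable_itv _) _ (measurable_torus_cube mA).
rewrite expr1n mul1e -lebesgue_torusE => H.
apply: le_trans (H _); last by move=> i B mB; rewrite mul1e; exact: lebesgue_circle_add_le.
rewrite lebesgue_torusE; apply: le_measure; rewrite ?inE.
- apply: measurable_torus_cube.
  by apply: (torus_preimage_measurable (@measurable_shift _ _ a)).
- apply: measurableI.
    by apply: measurable_tuple_box => i; exact: measurable_itv.
  rewrite -[X in measurable X]setTI; apply: measurable_tuple_map => //.
    by move=> i; exact: measurable_circle_add.
  exact: measurable_torus_cube.
move=> t [tc /= tA]; split=> [i|]; first by rewrite /D /= in_itv /= tc.
split=> /= [i|].
  rewrite tnth_mktuple /f /circle_add; have /andP[v0 v1] := fpart_itv (v ord0 i).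
  have /andP[t0 t1] := tc i.
  by case: ifPn => [?|]; rewrite -?leNgt => *; apply/andP; split; lra.
move: tA; rewrite -va -to_torusD; congr A; apply: to_torus_eq => i.
rewrite !mxE tnth_mktuple /f /circle_add /fpart.
set k := Num.floor _; case: ifP => _.
  by rewrite (_ : _ - _ = k%:~R)%R ?intr_int//; ring.
by rewrite (_ : _ - _ = (k + 1)%:~R)%R ?intr_int// intrD; ring.
Qed.

(** The inequality applied to [- a] and the translated set gives the converse. *)
Lemma lebesgue_shift (a : Omega) A : measurable A -> Leb [set x | A (a + x)%R] = Leb A.
Proof.
move=> mA; apply/eqP; rewrite eq_le lebesgue_shift_le//=.
have mB : measurable [set x | A (a + x)%R].
  by apply: (torus_preimage_measurable (@measurable_shift _ _ a)).
apply: le_trans (lebesgue_shift_le (- a)%R mB).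
rewrite (_ : [set x | _] = A)//; apply/seteqP; split=> x /=; by rewrite addNKr.
Qed.

(** Countably many translates of the ball, by rational points, cover the torus; if the ball were
    null, so would be the whole space. *)
Lemma lebesgue_tball_gt0 (N : vnorm R d) r : (0 < r)%R -> 0 < Leb (tball N r).
Proof.
move=> r0; rewrite lt0e measure_ge0 andbT; apply/eqP => B0.
pose F n := if unpickle n is Some q
  then [set x | tball N r (- rat_point R q + x)%R] else set0.
have mF n : measurable (F n).
  rewrite /F; case: (unpickle n) => [q|//].
  by apply: (torus_preimage_measurable (@measurable_shift _ _ _)); exact: measurable_tball.
have F0 n : Leb (F n) = 0.
  rewrite /F; case: (unpickle n) => [q|]; last exact: measure0.
  by rewrite lebesgue_shift//; exact: measurable_tball.
have FT : [set: Omega] `<=` \bigcup_n F n.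
  move=> x _; have [q qx] := rat_point_dense N x r0.
  by exists (pickle q) => //; rewrite /F pickleK /= addrC.
have : Leb setT <= \sum_(n <oo) Leb (F n).
  exact: (measure_sigma_subadditive _ mF measurableT FT).
rewrite lebesgue_torusT eseries0; last by move=> n _ _; exact: F0.
by rewrite lee_fin ler10.
Qed.

(* The affine image of a bounded region covers the torus a bounded number of times. *)
Lemma lebesgue_affine_image_le (N : vnorm R d) (a : 'rV[R]_d) (eps : R) : (0 < eps)%R ->
  exists2 K : R, (0 <= K)%R & forall A : set Omega, measurable A ->
    @lebesgue_rV R d ([set v | A (to_torus (a - eps *: v)%R)] `&` noise_ball N)
      <= K%:E * Leb A.
Proof.
move=> e0; have [C C0 NC] := norm_le_vnorm N.
(* Vectors of the noise ball have supremum norm at most [C], so every coordinate of [a - eps *: v]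
   has modulus below this integer. *)
pose n := (Num.truncn (`|a| + eps * C)).+1.
pose f (i : 'I_d) w := fpart (a ord0 i - eps * w)%R.
pose D (i : 'I_d) : set MR := [set w | (`|a ord0 i - eps * w| < n%:R)%R].
pose c := ((n.*2.+1)%:R / eps)%R.
have c0 : (0 <= c)%R by rewrite divr_ge0// ltW.
exists (c ^+ d)%R => [|A mA]; first exact: exprn_ge0.
have mD i : measurable (D i) by exact: measurable_affine_ball.
have mf i : measurable_fun setT (f i : MR -> MR) by exact: measurable_fpart_affine.
have H := lebesgue_tuple_map_le (c := c) (f := f) (D := D) c0 mf mD
   (fun i B mB => lebesgue_fpart_le (a ord0 i) n e0 mB) (measurable_torus_cube mA).
rewrite lebesgue_torusE; apply: le_trans H.
have mE : measurable_fun setT (fun v : 'rV[R]_d => to_torus (a - eps *: v)%R : Omega).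
  apply: measurable_torus_fun => U; rewrite open_torusE => oU; apply: open_measurable_rV.
  rewrite (_ : _ @^-1` _ = (fun v => a + (- eps) *: v)%R @^-1` (@to_torus R d @^-1` U)).
    by have /continuousP := @row_affine_continuous R d a (- eps)%R; exact.
  by apply/seteqP; split=> v /=; rewrite scaleNr.
rewrite /lebesgue_rV; apply: le_measure; rewrite ?inE.
- rewrite -[X in measurable X]setTI; apply: measurable_tuple_row => //.
  apply: measurableI; last exact: measurable_noise_ball.
  exact: torus_preimage_measurable mE mA.
- apply: measurableI; first exact: measurable_tuple_box.
  rewrite -[X in measurable X]setTI; apply: measurable_tuple_map => //.
  exact: measurable_torus_cube.
move=> t [/= tA tN]; split=> [i|].
  have tC : (`|tnth t i| <= C)%R.
    rewrite (le_trans _ (le_trans (NC _) (ler_piMr (ltW C0) tN)))//.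
    by have := coord_le_norm (tuple_row t) i; rewrite mxE.
  rewrite /D /= (le_lt_trans (ler_normB _ _))// (@le_lt_trans _ _ (`|a| + eps * C)%R)//.
    by rewrite lerD ?coord_le_norm// normrM gtr0_norm// ler_pM2l.
  exact: truncnS_gt.
split=> [i|]; first by rewrite tnth_mktuple; exact: fpart_itv.
move: tA; congr A; apply: to_torus_eq => i.
by rewrite !mxE tnth_mktuple /f /fpart subKr intr_int.
Qed.

End lebesgue_torus_theory.

Lemma ge0_fubini_sections d1 d2 (T1 : measurableType d1) (T2 : measurableType d2)
    (R : realType) (m1 : {sigma_finite_measure set T1 -> \bar R})
    (m2 : {sigma_finite_measure set T2 -> \bar R}) (A : set (T1 * T2)) :
  measurable A ->
  (\int[m1]_x m2 (xsection A x) = \int[m2]_y m1 (ysection A y))%E.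
Proof.
move=> mA; have := indic_fubini_tonelli m1 m2 mA.
by rewrite indic_fubini_tonelli_FE// indic_fubini_tonelli_GE.
Qed.

Lemma nonincreasing_measure_small d (T : measurableType d) (R : realType)
    (mu : {finite_measure set T -> \bar R}) (F : nat -> set T) (e : R) :
  (forall n, measurable (F n)) -> (forall n m, (n <= m)%N -> F m `<=` F n) ->
  \bigcap_n F n = set0 -> 0 < e -> exists n, (mu (F n) <= e%:E)%E.
Proof.
move=> mF dF F0 e0.
have H : (mu (F n) @[n --> \oo] --> mu (\bigcap_n F n))%E.
  apply: nonincreasing_cvg_mu => //.
  - by rewrite ltey_eq fin_num_measure.
  - exact: bigcap_measurable.
  - by move=> n m nm; exact/subsetPset/dF.
move: H; rewrite F0 measure0 => /fine_cvgP[_ /cvgrPdist_le /(_ _ e0)[n _ /(_ n (leqnn n))]].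
rewrite /= sub0r normrN => ne; exists n.
by rewrite -(fineK (fin_num_measure mu _ (mF n))) lee_fin (le_trans (ler_norm _)).
Qed.

Lemma measurable_torus_add (R : realType) d :
  measurable_fun setT (fun p : torus R d * torus R d => p.1 + p.2).
Proof.
rewrite (_ : (fun p => _) = (fun p : torus R d * torus R d => p.1 - p.2) \o
    (fun p : torus R d * torus R d => (p.1, - p.2))); last first.
  by apply/funext => p /=; rewrite opprK.
apply: measurableT_comp; first exact: measurable_torus_sub (mx_vnorm R d).
apply: measurable_fun_pair => //.
by apply: measurableT_comp => //; exact: measurable_torus_opp.
Qed.

(** * Continuity of translations in measure *)

Section translation_continuity.
Variables (R : realType) (d : nat) (N : vnorm R d).
Local Notation Omega := (torus R d).
Local Notation Leb := (@lebesgue_torus R d).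

Definition escape (A : set Omega) (v : Omega) := A `&` [set x | ~ A (v + x)].

Lemma measurable_escape A v : measurable A -> measurable (escape A v).
Proof.
move=> mA; apply: measurableI => //.
exact: (torus_preimage_measurable (@measurable_shift _ _ v) (measurableC mA)).
Qed.

(** L^1 continuity of translations for the indicator of [A], in one-sided form: the mass entering
    [A] is, up to a translation, the mass escaping under [- v]. Measurability is included so that
    the sets with this property can be shown to form a sigma-algebra. *)
Definition translation_continuous (A : set Omega) := measurable A /\
  forall e, 0 < e -> exists2 r, 0 < r &
    forall v, tball N r v -> (Leb (escape A v) <= e%:E)%E.

(** A point escaping under a short translation is close to the complement. The points of an open [A]
    within [r_ n] of the complement decrease to the empty set, hence have small measure. *)
Lemma translation_continuous_open A : open A -> translation_continuous A.
Proof.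
move=> oA; have mA := open_measurable_torus oA; split=> // e e0.
pose r_ n : R := n.+1%:R^-1.
pose B n := \bigcup_(c in ~` A) [set x | tball N (r_ n) (- c + x)].
have oB n : open (B n).
  by apply: bigcup_open => c _; apply: open_shift; exact: open_tball.
have [|n m nm|||n en] := @nonincreasing_measure_small _ _ _ Leb (fun n => A `&` B n) e.
- by move=> n; apply: measurableI => //; exact: open_measurable_torus.
- move=> x [Ax [c cA xc]]; split=> //; exists c => //.
  apply: tball_subset xc.
  by rewrite lef_pV2 ?posrE// ler_nat.
- apply/seteqP; split=> // x Hx; have [Ax _] := Hx 0%N Logic.I.
  have [r r0 rA] := tball_nbhs N oA Ax.
  have [n _ nN] := near_infty_natSinv_lt (PosNum r0).
  have [_ [c cA xc]] := Hx n Logic.I.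
  apply: cA; rewrite (_ : c = x + - (- c + x)); last by rewrite opprD opprK addrCA subrr addr0.
  apply: rA; apply/tball_opp; apply: tball_subset xc.
  by apply/ltW; exact: nN n (leqnn n).
- exact: e0.
exists (r_ n); first by rewrite invr_gt0.
move=> v vr; apply: le_trans en; apply: le_measure; rewrite ?inE.
- exact: measurable_escape.
- by apply: measurableI => //; exact: open_measurable_torus.
move=> x [Ax nA]; split=> //; exists (v + x) => //=.
by rewrite opprD subrK; exact/tball_opp.
Qed.

(** A point entering [A] under [v] is a translate of a point escaping [A] under [- v]. *)
Lemma translation_continuousC A : translation_continuous A -> translation_continuous (~` A).
Proof.
move=> [mA HA]; split; first exact: measurableC.
move=> e e0; have [r r0 rA] := HA e e0; exists r => // v vr.
rewrite (_ : escape _ _ = [set x | escape A (- v) (v + x)]); last first.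
  apply/seteqP; split=> x; rewrite /escape /= addKr => -[H1 H2]; split=> //.
  exact: contrapT.
rewrite lebesgue_shift; last exact: measurable_escape.
by apply: rA; exact/tball_opp.
Qed.

Lemma translation_continuousU A B : translation_continuous A -> translation_continuous B ->
  translation_continuous (A `|` B).
Proof.
move=> [mA HA] [mB HB]; split; first exact: measurableU.
move=> e e0; have [r r0 rA] := HA (e / 2) (divr_gt0 e0 (ltr0n R 2)).
have [s s0 sB] := HB (e / 2) (divr_gt0 e0 (ltr0n R 2)).
exists (Num.min r s) => [|v]; first by rewrite lt_min r0.
rewrite /tball /= lt_min => /andP[vr vs].
apply: (@le_trans _ _ (Leb (escape A v `|` escape B v))).
  apply: le_measure; rewrite ?inE.
  - by apply: measurable_escape; exact: measurableU.
  - by apply: measurableU; exact: measurable_escape.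
  - by move=> x [[Ax|Bx] /not_orP[nA nB]]; [left|right].
apply: (le_trans (measureU2 _ _ _)); [exact: measurable_escape..|].
by rewrite (splitr e) EFinD; apply: leeD; [exact: rA|exact: sB].
Qed.

(** A finite subunion misses at most [e / 2] of the measure, and a point escaping the full union
    either escapes that subunion or lies in the missed part. *)
Lemma translation_continuous_bigcup (A : nat -> set Omega) :
  (forall n, translation_continuous (A n)) -> translation_continuous (\bigcup_n A n).
Proof.
move=> HA; have mA : measurable (\bigcup_n A n).
  by apply: bigcupT_measurable => n; exact: (HA n).1.
split=> // e e0; pose U n := \big[setU/set0]_(i < n) A i.
have HU n : translation_continuous (U n).
  elim: n => [|n IH]; last by rewrite /U big_ord_recr; exact: translation_continuousU.
  by rewrite /U big_ord0; apply: translation_continuous_open; exact: open0.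
have mU n : measurable (U n) by exact: (HU n).1.
have [|n m nm|||n en] := @nonincreasing_measure_small _ _ _ Leb
  (fun n => (\bigcup_n A n) `\` U n) (e / 2).
- by move=> n; exact: measurableD.
- apply: setDS; rewrite /U -!bigcup_mkord => x [i /= im Ai].
  by exists i => //=; exact: leq_trans nm.
- apply/seteqP; split=> // x Hx; have [[n _ An] _] := Hx 0%N Logic.I.
  have [_] := Hx n.+1 Logic.I; apply; rewrite /U -bigcup_mkord.
  by exists n => //=.
- exact: divr_gt0.
have [r r0 rA] := (HU n).2 (e / 2) (divr_gt0 e0 (ltr0n R 2)).
exists r => // v vr.
apply: (@le_trans _ _ (Leb (escape (U n) v `|` ((\bigcup_n A n) `\` U n)))).
  apply: le_measure; rewrite ?inE.
  - exact: measurable_escape.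
  - by apply: measurableU; [exact: measurable_escape|exact: measurableD].
  - move=> x [Ax nA]; have [Ux|nU] := pselect (U n x); [left|by right].
    split=> //= Uv; apply: nA; move: Uv; rewrite /U -bigcup_mkord => -[i _ Ai].
    by exists i.
apply: (le_trans (measureU2 _ _ _)); [exact: measurable_escape|exact: measurableD|].
by rewrite (splitr e) EFinD; apply: leeD; [exact: rA|exact: en].
Qed.

Lemma measurable_translation_continuous A : measurable A -> translation_continuous A.
Proof.
move: A; apply: (@smallest_sub _ _ _ translation_continuous).
  split.
  - by apply: translation_continuous_open; exact: open0.
  - by move=> A HA; rewrite setTD; exact: translation_continuousC.
  - exact: translation_continuous_bigcup.
exact: translation_continuous_open.
Qed.

(** Its section at [x] measures how far [\1_A] is from constant on [x + V]; integrated over [x],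
    this is the mean oscillation of [\1_A] at the scale of [V]. *)
Definition crossing (A V : set Omega) : set (Omega * Omega) :=
  [set p | V p.2 /\ (A p.1 <-> ~ A (p.1 + p.2))].

Lemma measurable_crossing A V : measurable A -> measurable V -> measurable (crossing A V).
Proof.
move=> mA mV.
have m1 : measurable [set p : Omega * Omega | A p.1].
  by rewrite -[X in measurable X]setTI; exact: measurable_fst.
have m2 : measurable [set p : Omega * Omega | V p.2].
  by rewrite -[X in measurable X]setTI; exact: measurable_snd.
have m3 : measurable [set p : Omega * Omega | A (p.1 + p.2)].
  by rewrite -[X in measurable X]setTI; exact: measurable_torus_add.
rewrite (_ : crossing A V = [set p | V p.2] `&`
   (([set p | A p.1] `&` ~` [set p | A (p.1 + p.2)]) `|`
    (~` [set p | A p.1] `&` [set p | A (p.1 + p.2)]))).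
  by apply: measurableI => //; apply: measurableU; apply: measurableI => //; exact: measurableC.
apply/seteqP; split=> -[x v] /= [Vv H]; split=> //=.
  have [Ax|nA] := pselect (A x); [by left; split=> //; exact/H|right; split=> //].
  by apply: contrapT => /H.
by case: H => -[H1 H2]; split.
Qed.

(** Integrating over [x] first, at fixed [v], leaves the mass that [v] carries out of [A] or into
    it; either is at most [e / 2] when [v] is short. *)
Lemma crossing_small A e : measurable A -> 0 < e -> exists2 r0, 0 < r0 &
  forall r, r <= r0 -> (\int[Leb]_x Leb (xsection (crossing A (tball N r)) x)
    <= e%:E * Leb (tball N r))%E.
Proof.
move=> mA e0; have [_ HA] := measurable_translation_continuous mA.
have [r0 r00 rA] := HA (e / 2) (divr_gt0 e0 (ltr0n R 2)); exists r0 => // r rr.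
have mV := measurable_tball N r.
have mC := measurable_crossing mA mV.
rewrite (ge0_fubini_sections _ _ mC) -integral_cst// [leRHS]integral_mkcond.
apply: ge0_le_integral => //.
- exact: measurable_fun_ysection.
- by apply: (iffLR (measurable_restrictT _ mV)); exact: measurable_cst.
move=> v _; rewrite patchE; case: ifPn => [|/negP] vr; last first.
  rewrite (_ : ysection _ _ = set0) ?measure0//; apply/seteqP; split=> // x.
  by rewrite /ysection /= inE => -[] /= /mem_set.
move: vr; rewrite inE => vr.
have vr' := tball_subset rr vr.
apply: (@le_trans _ _ (Leb (escape A v `|` [set x | escape A (- v) (v + x)]))).
  apply: le_measure; rewrite ?inE.
  - exact: measurable_ysection.
  - apply: measurableU; first exact: measurable_escape.
    exact: (torus_preimage_measurable (@measurable_shift _ _ v) (measurable_escape _ mA)).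
  - move=> x; rewrite /ysection /= inE /escape /= addKr => -[/= _].
    rewrite addrC => H; have [Ax|nA] := pselect (A x); [left|right]; first by split=> //; exact/H.
    by split=> //; apply: contrapT => /H.
apply: (le_trans (measureU2 _ _ _)).
- exact: measurable_escape.
- exact: (torus_preimage_measurable (@measurable_shift _ _ v) (measurable_escape _ mA)).
rewrite (splitr e) EFinD; apply: leeD; first exact: rA.
have /(rA _) : tball N r0 (- v) by exact/tball_opp.
by rewrite -(lebesgue_shift v (measurable_escape _ mA)).
Qed.

End translation_continuity.

(** * Approximation of a bounded density by a simple function *)

(** The number [s] is the largest multiple of [e] below both [y] and [n%:R * e], written as a sum
    over levels so that each term becomes the indicator of a superlevel set. *)
Lemma staircase_bounds (R : realType) (e y : R) (n : nat) : 0 < e -> 0 <= y ->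
  let s := \sum_(i < n) e * ((i.+1)%:R * e <= y)%R%:R in
  s <= y /\ (y <= n%:R * e -> y <= s + e).
Proof.
move=> e0 y0; pose s n := \sum_(i < n) e * ((i.+1)%:R * e <= y)%R%:R.
rewrite -/(s n) /=.
have sS k : s k.+1 = s k + e * ((k.+1)%:R * e <= y)%R%:R by rewrite /s big_ord_recr.
have s_le k : s k <= k%:R * e.
  elim: k => [|k IH]; first by rewrite /s big_ord0 mul0r.
  by rewrite sS -natr1 mulrDl mul1r lerD// ler_piMr ?(ltW e0)//; case: (_ <= y); rewrite ?lexx ?ler01.
have s_ge k : k%:R * e <= y -> k%:R * e <= s k.
  elim: k => [|k IH] ky; first by rewrite /s big_ord0 mul0r.
  rewrite sS ky mulr1 -natr1 mulrDl mul1r lerD2r IH// (le_trans _ ky)//.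
  by rewrite ler_wpM2r ?(ltW e0)// ler_nat.
split.
  elim: n => [|n IH]; first by rewrite /s big_ord0.
  rewrite sS; case: (boolP (_ <= y)) => ny; last by rewrite mulr0 addr0.
  by rewrite mulr1 (le_trans _ ny)// -natr1 mulrDl mul1r lerD2r.
elim: n => [|n IH] ny; first by rewrite (le_trans ny)// mul0r /s big_ord0 add0r ltW.
rewrite sS; have [yn|/ltW yn] := leP y (n%:R * e).
  by rewrite (le_trans (IH yn))// lerD2r lerDl mulr_ge0// ltW.
rewrite (le_trans ny)// -natr1 mulrDl mul1r lerD2r (le_trans (s_ge _ yn))//.
by rewrite lerDl mulr_ge0// ltW.
Qed.

(** The sets [A i] are superlevel sets of the Radon-Nikodym density, and [e] times the sum of their
    indicators is its staircase approximation. The result is phrased through measures of sets, so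
    the density does not appear in it. *)
Lemma simple_density d (T : measurableType d) (R : realType)
    (mu nu : {finite_measure set T -> \bar R}) (K e : R) : 0 < e ->
  (forall A, measurable A -> nu A <= K%:E * mu A)%E ->
  exists (n : nat) (A : nat -> set T), (forall i, measurable (A i)) /\
    forall E, measurable E ->
    (e%:E * \sum_(i < n) mu (A i `&` E) <= nu E /\
     nu E <= e%:E * \sum_(i < n) mu (A i `&` E) + e%:E * mu E)%E.
Proof.
move=> e0 nuK; have numu : nu `<< mu.
  apply/null_content_dominatesP => A mA muA0.
  by apply/eqP; rewrite eq_le measure_ge0 andbT (le_trans (nuK _ mA))// muA0 mule0.
have [f [f0 /measurable_int mf fE]] := radon_nikodym_finite numu.
pose n := (Num.truncn (K / e)).+1.
have nK : K < n%:R * e by rewrite -ltr_pdivrMr//; exact: truncnS_gt.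
pose A i := [set x | (((i.+1)%:R * e)%:E <= f x)%E].
have mA i : measurable (A i).
  by rewrite -[A i]setTI; exact: emeasurable_fun_c_infty.
(* Above the top level the staircase fails, but [n%:R * e] exceeds [K], so domination of [nu] makes
   this set null. *)
pose B := [set x | ((n%:R * e)%:E < f x)%E].
have mB : measurable B by rewrite -[B]setTI; exact: emeasurable_fun_o_infty.
have B0 : mu B = 0%E.
  have muBf : mu B \is a fin_num by exact: fin_num_measure.
  have H : ((n%:R * e)%:E * mu B <= K%:E * mu B)%E.
    apply: le_trans (nuK _ mB); rewrite fE// -integral_cst//.
    apply: ge0_le_integral => //.
    - by move=> x _; rewrite lee_fin mulr_ge0// ltW.
    - exact: measurable_funTS.
    - by move=> x /ltW.
  move: H; rewrite -(fineK muBf) -!EFinM lee_fin => H; congr EFin.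
  apply/eqP; rewrite eq_le; apply/andP; split; last by rewrite fine_ge0.
  by rewrite leNgt; apply/negP => muB0; move: H; rewrite ler_pM2r// leNgt nK.
exists n, A; split=> // E mE.
pose s x : \bar R := (\sum_(i < n) (e * \1_(A i) x)%:E)%E.
have s0 x : (0 <= s x)%E.
  by apply: sume_ge0 => i _; rewrite lee_fin mulr_ge0 ?(ltW e0)// indicE.
have mi i : measurable_fun setT (fun x => (e * \1_(A i) x)%:E).
  apply/measurable_EFinP; apply: measurable_funM; first exact: measurable_cst.
  exact: measurable_indic.
have ms : measurable_fun setT s by apply: emeasurable_sum => i; exact: mi.
have sE : (\int[mu]_(x in E) s x = e%:E * \sum_(i < n) mu (A i `&` E))%E.
  rewrite /s ge0_integral_sum//; last 2 first.
  - by move=> i; apply: measurable_funTS; exact: mi.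
  - by move=> i x _; rewrite lee_fin mulr_ge0 ?(ltW e0)// indicE.
  rewrite ge0_sume_distrr => [|i _]; last exact: measure_ge0.
  apply: eq_bigr => i _; under eq_integral do rewrite EFinM.
  rewrite ge0_integralZl_EFin ?(ltW e0)//; first by rewrite integral_indic.
  by apply: measurable_funTS; apply/measurable_EFinP.
have sfin x : s x = (\sum_(i < n) e * \1_(A i) x)%:E by rewrite /s sumEFin.
have AE i x y : f x = y%:E -> \1_(A i) x = ((i.+1)%:R * e <= y)%R%:R :> R.
  by move=> fx; rewrite indicE; congr ((nat_of_bool _)%:R); apply/idP/idP; rewrite inE /A /= fx lee_fin.
have sf x : (s x <= f x)%E /\ (~ B x -> (f x <= s x + e%:E)%E).
  have := f0 x; case fx : (f x) => [y||] // y0; last first.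
    by split; [exact: leey|rewrite /B /= fx ltry].
  have [H1 H2] := staircase_bounds n e0 y0.
  rewrite sfin; under eq_bigr do rewrite (AE _ _ _ fx).
  split; first by rewrite lee_fin.
  by rewrite /B /= fx lte_fin -EFinD lee_fin => /negP; rewrite -leNgt => /H2.
rewrite -sE fE//; split.
  apply: ge0_le_integral => //; [exact: measurable_funTS..|].
  by move=> x _; exact: (sf x).1.
rewrite -integral_cst// -ge0_integralD//;
  [|exact: measurable_funTS|by move=> x _; rewrite lee_fin (ltW e0)].
apply: ae_ge0_le_integral => //.
- exact: measurable_funTS.
- by move=> x _; rewrite adde_ge0// lee_fin (ltW e0).
- by apply: emeasurable_funD => //; exact: measurable_funTS.
exists B; split=> // x /= nx; apply: contrapT => nB; apply: nx => _.
exact: (sf x).2.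
Qed.

(** * Probability that a law with bounded density hits a small ball *)

Section hitting_probability.
Variables (R : realType) (d : nat) (N : vnorm R d) (kap : probability (torus R d) R) (K : R).
Local Notation Omega := (torus R d).
Local Notation Leb := (@lebesgue_torus R d).
Hypothesis kapK : forall A, measurable A -> (kap A <= K%:E * Leb A)%E.

Definition near_set (r : R) (x : Omega) : set Omega := [set y | tball N r (x - y)].

Definition near_pairs (r : R) : set (Omega * Omega) := [set p | tball N r (p.1 - p.2)].

Lemma measurable_near_pairs r : measurable (near_pairs r).
Proof.
rewrite -[X in measurable X]setTI.
by apply: (measurable_torus_sub (mx_vnorm R d)) => //; exact: measurable_tball.
Qed.

Lemma near_setE r x : near_set r x = xsection (near_pairs r) x.
Proof. by apply/seteqP; split=> y; rewrite /xsection /= inE. Qed.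

Lemma measurable_near_set r x : measurable (near_set r x).
Proof. by rewrite near_setE; apply: measurable_xsection; exact: measurable_near_pairs. Qed.

Lemma near_set_shift r x : near_set r x = [set y | tball N r (- x + y)].
Proof.
have E y : - x + y = - (x - y) by rewrite opprB addrC.
by apply/seteqP; split=> y /=; rewrite /near_set /= E => /tball_opp.
Qed.

Lemma lebesgue_near_set r x : Leb (near_set r x) = Leb (tball N r).
Proof. by rewrite near_set_shift lebesgue_shift//; exact: measurable_tball. Qed.

Definition hit r x : R := fine (kap (near_set r x)).
Definition vol r : R := fine (Leb (tball N r)).

Lemma volE r : (vol r)%:E = Leb (tball N r).
Proof. by rewrite fineK// fin_num_measure//; exact: measurable_tball. Qed.

Lemma hitE r x : (hit r x)%:E = kap (near_set r x).
Proof. by rewrite fineK// fin_num_measure//; exact: measurable_near_set. Qed.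

Lemma hit_ge0 r x : 0 <= hit r x.
Proof. by rewrite fine_ge0. Qed.

Lemma hit_le1 r x : hit r x <= 1.
Proof. by rewrite -lee_fin hitE probability_le1//; exact: measurable_near_set. Qed.

Lemma hit_le r x : hit r x <= K * vol r.
Proof.
rewrite -lee_fin hitE EFinM volE -(lebesgue_near_set r x).
by apply: kapK; exact: measurable_near_set.
Qed.

Lemma measurable_hit r : measurable_fun setT (hit r).
Proof.
rewrite (_ : hit r = fine \o (fun x => kap (xsection (near_pairs r) x))); last first.
  by apply/funext => x; rewrite /hit near_setE.
apply: measurableT_comp => //; apply: measurable_fun_xsection.
exact: measurable_near_pairs.
Qed.

(** With the order of integration exchanged, each [y] contributes the volume of a ball centred at
    [y], and [kap] has mass one. This ties the volume to the exceedance probability. *)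
Lemma integral_hit r : (\int[Leb]_x (hit r x)%:E = (vol r)%:E)%E.
Proof.
under eq_integral do rewrite hitE near_setE.
rewrite (ge0_fubini_sections _ _ (measurable_near_pairs r)).
rewrite (eq_integral (cst (vol r)%:E)).
  by rewrite integral_cst// -[RHS]mule1; congr (_ * _)%E; exact: probability_setT.
move=> y _; rewrite volE -(lebesgue_shift (- y)) ?measurable_tball//; last exact: measurable_tball.
by congr (Leb _); apply/seteqP; split=> x; rewrite /ysection /= inE /near_pairs /= addrC.
Qed.

(** An L^1 differentiation theorem with error relative to the volume. Half of [e] pays for replacing
    [kap] by its simple density; the other half pays for replacing the measure of each [A i] in the
    ball by [vol r] or zero, according to whether the centre lies in [A i]. *)
Lemma hit_approx e : 0 < e -> exists (n : nat) (A : nat -> set Omega) (c r0 : R),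
  [/\ forall i, measurable (A i), 0 <= c, 0 < r0 & forall r, r <= r0 ->
    (\int[Leb]_x `|hit r x - vol r * \sum_(i < n) c * \1_(A i) x|%:E <= (e * vol r)%:E)%E].
Proof.
move=> e0; have eta0 : 0 < e / 2 by exact: divr_gt0.
have [n [A [mA AE]]] := simple_density eta0 kapK; set eta := e / 2 in eta0 AE.
(* Each of the [n] sets gets an equal share; the successor covers [n = 0]. *)
have n0 : 0 < n.+1%:R^-1 :> R by rewrite invr_gt0.
pose h r i x := Leb (xsection (crossing (A i) (tball N r)) x).
have /choice[rho rhoP] : forall i, exists r0, 0 < r0 /\ forall r, r <= r0 ->
    (\int[Leb]_x h r i x <= (n.+1%:R^-1)%:E * Leb (tball N r))%E.
  by move=> i; have [r0 r00 H] := crossing_small N (mA i) n0; exists r0.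
exists n, A, eta, (\big[Num.min/1]_(i < n) rho i); split=> //.
- exact: ltW.
- by apply: lt_bigmin => [|i _]; [exact: ltr01|exact: (rhoP i).1].
move=> r rr.
have rri (i : 'I_n) : r <= rho i by rewrite (le_trans rr)// bigmin_le_cond.
have mh i : measurable (crossing (A i) (tball N r)).
  by apply: measurable_crossing => //; exact: measurable_tball.
have hfin i x : h r i x \is a fin_num.
  by apply: fin_num_measure; exact: measurable_xsection.
(* Recentred at [x], the error is the part of the ball outside [Q] if [x] lies in [A i], and the
   part inside otherwise; both are sections of [crossing]. *)
have diff i x : `|fine (Leb (A i `&` near_set r x)) - vol r * \1_(A i) x| <= fine (h r i x).
  pose V := tball N r; pose Q := [set v | A i (x + v)].
  have mV : measurable V by exact: measurable_tball.
  have mQ : measurable Q by exact: (torus_preimage_measurable (@measurable_shift _ _ x) (mA i)).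
  have -> : Leb (A i `&` near_set r x) = Leb (V `&` Q).
    rewrite -(lebesgue_shift x); last by apply: measurableI => //; exact: measurable_near_set.
    congr (Leb _); apply/seteqP; split=> v; rewrite /near_set /V /Q /= opprD addNKr.
      by move=> [? /tball_opp].
    by move=> [? ?]; split=> //; exact/tball_opp.
  have f1 : Leb (V `&` Q) \is a fin_num by apply: fin_num_measure; exact: measurableI.
  have f2 : Leb (V `\` Q) \is a fin_num by apply: fin_num_measure; exact: measurableD.
  have volVQ : vol r = fine (Leb (V `&` Q)) + fine (Leb (V `\` Q)).
    rewrite -fineD// -measureU; [|exact: measurableI|exact: measurableD|].
      by rewrite setUIDK.
    by apply/seteqP; split=> // v [[_ q] [_ nq]].
  rewrite indicE; case: (boolP (x \in A i)) => xA.
    rewrite mulr1 volVQ opprD addNKr normrN ger0_norm ?fine_ge0//.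
    rewrite /h (_ : xsection _ _ = V `\` Q)//.
    move: xA; rewrite inE => xA; apply/seteqP; split=> v; rewrite /xsection /= inE /crossing /=.
      by move=> [vV H]; split=> //; exact/H.
    by move=> [vV nq]; split.
  rewrite mulr0 subr0 ger0_norm ?fine_ge0//.
  rewrite /h (_ : xsection _ _ = V `&` Q)//.
  move: xA; rewrite notin_setE => xA; apply/seteqP; split=> v; rewrite /xsection /= inE /crossing /=.
    by move=> [vV H]; split=> //; apply: contrapT => /H.
  by move=> [vV q]; split.
have pw x : (`|hit r x - vol r * \sum_(i < n) eta * \1_(A i) x|%:E <=
    (eta * vol r)%:E + eta%:E * \sum_(i < n) h r i x)%E.
  have [] : (eta%:E * \sum_(i < n) Leb (A i `&` near_set r x) <= kap (near_set r x) /\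
      kap (near_set r x) <= eta%:E * \sum_(i < n) Leb (A i `&` near_set r x) +
        eta%:E * Leb (near_set r x))%E := AE _ (measurable_near_set r x).
  rewrite -hitE lebesgue_near_set -volE.
  have E1 : (\sum_(i < n) Leb (A i `&` near_set r x) =
     (\sum_(i < n) fine (Leb (A i `&` near_set r x)))%:E)%E.
    rewrite -sumEFin; apply: eq_bigr => i _; rewrite fineK//.
    by apply: fin_num_measure; apply: measurableI => //; exact: measurable_near_set.
  have E2 : (\sum_(i < n) h r i x = (\sum_(i < n) fine (h r i x))%:E)%E.
    by rewrite -sumEFin; apply: eq_bigr => i _; rewrite fineK.
  rewrite E1 E2 -!EFinM -!EFinD !lee_fin => H1 H2.
  set S := \sum_(i < n) fine (Leb _) in H1 H2.
  have H3 : `|S - vol r * \sum_(i < n) \1_(A i) x| <= \sum_(i < n) fine (h r i x).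
    rewrite mulr_sumr /S -sumrB (le_trans (ler_norm_sum _ _ _))// ler_sum//.
  have E3 : \sum_(i < n) eta * \1_(A i) x = eta * \sum_(i < n) \1_(A i) x.
    by rewrite mulr_sumr.
  rewrite E3 (_ : hit r x - _ = (hit r x - eta * S) +
    eta * (S - vol r * \sum_(i < n) \1_(A i) x)); last by ring.
  rewrite (le_trans (ler_normD _ _))// lerD//.
    by rewrite ler_norml; apply/andP; split; lra.
  by rewrite normrM gtr0_norm// ler_pM2l.
have mhi i : measurable_fun setT (h r i) by apply: measurable_fun_xsection.
have hs0 x : (0 <= \sum_(i < n) h r i x)%E by apply: sume_ge0 => i _; exact: measure_ge0.
apply: (@le_trans _ _ (\int[Leb]_x ((eta * vol r)%:E + eta%:E * \sum_(i < n) h r i x))%E).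
  apply: ge0_le_integral => //.
  - apply/measurable_EFinP; apply: measurableT_comp => //; apply: measurable_funB; first exact: measurable_hit.
    apply: measurable_funM => //; apply: measurable_sum => i; apply: measurable_funM => //.
  - by apply: emeasurable_funD => //; apply: measurable_funeM; apply: emeasurable_sum => i.
rewrite ge0_integralD//; last 3 first.
- by move=> x _; rewrite lee_fin mulr_ge0 ?(ltW eta0)// fine_ge0.
- by move=> x _; rewrite mule_ge0// lee_fin (ltW eta0).
- by apply: measurable_funeM; apply: emeasurable_sum => i.
rewrite integral_cst// (_ : _ * _ = (eta * vol r)%:E)%E; last first.
  by rewrite -[RHS]mule1; congr (_ * _)%E; exact: lebesgue_torusT.
rewrite ge0_integralZl_EFin ?(ltW eta0)//; last by apply: emeasurable_sum => i.
rewrite ge0_integral_sum//.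
apply: (@le_trans _ _ ((eta * vol r)%:E + eta%:E * \sum_(i < n) ((n.+1%:R^-1) * vol r)%:E)%E).
  rewrite leeD2l// lee_wpmul2l ?lee_fin ?(ltW eta0)// lee_sum// => i _.
  by rewrite EFinM volE; apply: (rhoP i).2.
rewrite sumEFin -EFinM -EFinD lee_fin sumr_const card_ord -[_ *+ n]mulr_natl.
have -> : e * vol r = eta * vol r + eta * vol r by rewrite /eta; field.
rewrite lerD2l ler_pM2l// mulrA ler_piMl ?fine_ge0//.
by rewrite ler_pdivrMr// mul1r ler_nat.
Qed.

End hitting_probability.

(** * Means of bounded measurable functions *)

Section mean.
Context d (W : measurableType d) (R : realType) (nu : probability W R).
Implicit Types f g : W -> R.

Definition bdd f := measurable_fun setT f /\ exists M, forall x, `|f x| <= M.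
Definition mean f : R := \int[nu]_x f x.

Lemma bdd_integrable f : bdd f -> nu.-integrable setT (EFin \o f).
Proof.
move=> [mf [M fM]]; apply: measurable_bounded_integrable => //.
  by rewrite ltey_eq fin_num_measure.
exists M; split; first exact: num_real.
by move=> x Mx y _; apply: (le_trans (fM y)); exact: ltW.
Qed.

Lemma bdd_cst (c : R) : bdd (cst c).
Proof. by split=> //; exists `|c|. Qed.

Lemma bddD f g : bdd f -> bdd g -> bdd (fun x => f x + g x).
Proof.
move=> [mf [M fM]] [mg [M' gM]]; split; first exact: measurable_funD.
by exists (M + M') => x; rewrite (le_trans (ler_normD _ _))// lerD.
Qed.

Lemma bddM f g : bdd f -> bdd g -> bdd (fun x => f x * g x).
Proof.
move=> [mf [M fM]] [mg [M' gM]]; split; first exact: measurable_funM.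
by exists (M * M') => x; rewrite normrM ler_pM.
Qed.

Lemma bddZ (c : R) f : bdd f -> bdd (fun x => c * f x).
Proof. exact: (bddM (bdd_cst c)). Qed.

Lemma bddN f : bdd f -> bdd (fun x => - f x).
Proof.
by move=> /(bddZ (-1)); congr bdd; apply/funext => x; rewrite mulN1r.
Qed.

Lemma bddB f g : bdd f -> bdd g -> bdd (fun x => f x - g x).
Proof. by move=> bf /bddN; exact: bddD. Qed.

Lemma bdd_norm f : bdd f -> bdd (fun x => `|f x|).
Proof.
move=> [mf [M fM]]; split; first exact: measurableT_comp.
by exists M => x; rewrite normr_id.
Qed.

Lemma bdd_sum n (f : nat -> W -> R) : (forall i, bdd (f i)) ->
  bdd (fun x => \sum_(i < n) f i x).
Proof.
move=> bf; elim: n => [|n IH].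
  by rewrite (_ : (fun x => _) = cst 0); [exact: bdd_cst|apply/funext => x; rewrite big_ord0].
rewrite (_ : (fun x => _) = fun x => \sum_(i < n) f i x + f n x); first exact: bddD.
by apply/funext => x; rewrite big_ord_recr.
Qed.

Lemma bdd_prod n (f : nat -> W -> R) : (forall i, bdd (f i)) ->
  bdd (fun x => \prod_(i < n) f i x).
Proof.
move=> bf; elim: n => [|n IH].
  by rewrite (_ : (fun x => _) = cst 1); [exact: bdd_cst|apply/funext => x; rewrite big_ord0].
rewrite (_ : (fun x => _) = fun x => (\prod_(i < n) f i x) * f n x); first exact: bddM.
by apply/funext => x; rewrite big_ord_recr.
Qed.

Lemma bdd_indic A : measurable A -> bdd (\1_A : W -> R).
Proof.
move=> mA; split; first exact: measurable_indic.
by exists 1 => x; rewrite indicE; case: (_ \in _); rewrite ?normr1 ?normr0.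
Qed.

Lemma bdd_comp f (h : W -> W) : measurable_fun setT h -> bdd f -> bdd (f \o h).
Proof.
by move=> mh [mf [M fM]]; split; [exact: measurableT_comp|exists M => x; exact: fM].
Qed.

Lemma meanD f g : bdd f -> bdd g -> mean (fun x => f x + g x) = mean f + mean g.
Proof. by move=> /bdd_integrable bf /bdd_integrable bg; exact: RintegralD. Qed.

Lemma meanB f g : bdd f -> bdd g -> mean (fun x => f x - g x) = mean f - mean g.
Proof. by move=> /bdd_integrable bf /bdd_integrable bg; exact: RintegralB. Qed.

Lemma meanZ c f : bdd f -> mean (fun x => c * f x) = c * mean f.
Proof. by move=> /bdd_integrable bf; exact: RintegralZl. Qed.

Lemma mean_cst c : mean (cst c) = c.
Proof.
rewrite /mean Rintegral_cst// -[RHS]mulr1; congr (_ * _).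
by rewrite -[RHS]/(fine 1%E); congr fine; exact: probability_setT.
Qed.

Lemma mean_le f g : bdd f -> bdd g -> (forall x, f x <= g x) -> mean f <= mean g.
Proof. by move=> /bdd_integrable bf /bdd_integrable bg fg; exact: le_Rintegral. Qed.

Lemma mean_ge0 f : (forall x, 0 <= f x) -> 0 <= mean f.
Proof. by move=> f0; apply: Rintegral_ge0. Qed.

Lemma norm_mean_le f : bdd f -> `|mean f| <= mean (fun x => `|f x|).
Proof. by move=> /bdd_integrable bf; exact: le_normr_Rintegral. Qed.

Lemma mean_sum n (f : nat -> W -> R) : (forall i, bdd (f i)) ->
  mean (fun x => \sum_(i < n) f i x) = \sum_(i < n) mean (f i).
Proof.
move=> bf; elim: n => [|n IH].
  rewrite big_ord0 -[RHS]mean_cst; congr mean; apply/funext => x; exact: big_ord0.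
rewrite big_ord_recr /= -IH -meanD //; last exact: bdd_sum.
by congr mean; apply/funext => x; rewrite big_ord_recr.
Qed.

Lemma mean_indic A : measurable A -> mean \1_A = fine (nu A).
Proof. by move=> mA; rewrite /mean /Rintegral integral_indic// setIT. Qed.

End mean.

(** * Comparison of products with exponentials *)

Section product_estimates.
Variable R : realType.
Implicit Types a b x : R.

(** From [1 - a <= expR (- a)] and [expR (- a) <= 1 / (1 + a) <= 1 - a + a ^+ 2]. *)
Lemma expRN_le_quad a : 0 <= a -> `|1 - a - expR (- a)| <= a ^+ 2.
Proof.
move=> a0; have H1 := expR_ge1Dx (- a).
have H2 : expR (- a) * (1 + a) <= 1.
  apply: (@le_trans _ _ (expR (- a) * expR a)); last by rewrite -expRD addNr expR0.
  by rewrite ler_pM2l ?expR_gt0//; exact: expR_ge1Dx.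
rewrite ler_norml; apply/andP; split; last by nra.
have : expR (- a) <= (1 - a + a ^+ 2).
  rewrite -(@ler_pM2r _ (1 + a)); last by nra.
  apply: le_trans H2 _; rewrite (_ : _ * _ = 1 + a ^+ 3); last by ring.
  by rewrite lerDl exprn_ge0.
by lra.
Qed.

Lemma expRN_le1 a : 0 <= a -> expR (- a) <= 1.
Proof. by move=> a0; rewrite -(expR0 R) ler_expR oppr_le0. Qed.

Lemma expRN_lipschitz a b : 0 <= a -> 0 <= b -> `|expR (- a) - expR (- b)| <= `|a - b|.
Proof.
wlog ab : a b / a <= b => [H a0 b0|a0 b0].
  have [ab|/ltW ba] := leP a b; first exact: H.
  by rewrite distrC (distrC a); exact: H.
rewrite ger0_norm ?subr_ge0 ?ler_expR ?lerN2// ler0_norm ?subr_le0//.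
have -> : - b = - a + - (b - a) by ring.
rewrite expRD; have := @expR_ge1Dx R (- (b - a)); have := expRN_le1 a0.
by have := expR_gt0 (- a); nra.
Qed.

(** Factors are exchanged one at a time; all of them lie between zero and one, so the quadratic
    errors simply add up. *)
Lemma prod_exp_le n (a : nat -> R) : (forall i, 0 <= a i <= 1) ->
  `|\prod_(i < n) (1 - a i) - expR (- \sum_(i < n) a i)| <= \sum_(i < n) (a i) ^+ 2.
Proof.
move=> a01; have p01 k : 0 <= \prod_(i < k) (1 - a i) <= 1.
  elim: k => [|k /andP[IH1 IH2]]; first by rewrite big_ord0 lexx ler01.
  by rewrite big_ord_recr /=; have /andP[? ?] := a01 k; apply/andP; split; nra.
elim: n => [|n IH]; first by rewrite !big_ord0 oppr0 expR0 subrr normr0.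
rewrite !big_ord_recr /= opprD expRD.
set p := \prod_(i < n) _ in IH *; set s := \sum_(i < n) a i in IH *.
have /andP[an0 an1] := a01 n.
have -> : p * (1 - a n) - expR (- s) * expR (- a n) =
  (p - expR (- s)) * (1 - a n) + expR (- s) * (1 - a n - expR (- a n)) by ring.
rewrite (le_trans (ler_normD _ _))// lerD//.
  rewrite normrM (le_trans _ IH)// ler_piMr// ger0_norm; lra.
rewrite normrM (le_trans _ (expRN_le_quad an0))// ler_piMl// ger0_norm ?expR_ge0//.
by apply: expRN_le1; apply: sumr_ge0 => i _; have /andP[] := a01 i.
Qed.

End product_estimates.

(** * The mean ergodic theorem from mixing *)

Section mean_ergodic.
Context d (W : measurableType d) (R : realType) (nu : probability W R).
Variable T : W -> W.
Hypothesis mT : measurable_fun setT T.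
Hypothesis invT : forall A, measurable A -> nu (T @^-1` A) = nu A.
Local Notation mean := (mean nu).

Lemma measurable_iter n : measurable_fun setT (iter n T).
Proof.
elim: n => [|n IH]; first exact: measurable_id.
exact: (measurableT_comp mT IH).
Qed.

Lemma bdd_iter (f : W -> R) n : bdd f -> bdd (fun x => f (iter n T x)).
Proof. by move=> bf; exact: (bdd_comp (measurable_iter n) bf). Qed.

Lemma mean_T (f : W -> R) : bdd f -> mean (fun x => f (T x)) = mean f.
Proof.
move=> bf; rewrite /mean /Rintegral; congr fine.
have bfT : nu.-integrable (T @^-1` setT) ((EFin \o f) \o T).
  by rewrite preimage_setT; exact: (bdd_integrable nu (bdd_comp mT bf)).
transitivity (\int[pushforward nu T]_x (f x)%:E)%E.
  rewrite (integral_pushforward mT _ bfT) ?preimage_setT//.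
  by apply/measurable_EFinP; exact: bf.1.
by apply: eq_measure_integral => A mA _; exact: invT.
Qed.

Lemma mean_iter (f : W -> R) n : bdd f -> mean (fun x => f (iter n T x)) = mean f.
Proof.
move=> bf; elim: n => [//|n IH].
rewrite -[RHS]IH -[RHS](mean_T (bdd_iter n bf)); congr mean.
by apply/funext => x; rewrite iterSr.
Qed.

Definition birkhoff (f : W -> R) (l : nat) (x : W) : R := \sum_(i < l) f (iter i T x).

Lemma bdd_birkhoff f l : bdd f -> bdd (birkhoff f l).
Proof.
move=> bf; exact: (bdd_sum _ (fun i => bdd_iter i bf)).
Qed.

Lemma mean_birkhoff f l : bdd f -> mean (birkhoff f l) = l%:R * mean f.
Proof.
move=> bf; rewrite /birkhoff (mean_sum _ _ (fun i => bdd_iter i bf)).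
rewrite (eq_bigr (fun=> mean f)) => [|i _]; last exact: mean_iter.
by rewrite sumr_const card_ord mulr_natl.
Qed.

Lemma bdd_discrepancy f l : bdd f -> bdd (fun x => birkhoff f l x - l%:R * mean f).
Proof. by move=> bf; apply: bddB; [exact: bdd_birkhoff|exact: bdd_cst]. Qed.

(** The L^1 ergodic theorem for [f] with constant limit, multiplied by [l] to avoid division. It is
    stable under linear combinations, hence passes from indicators to simple functions. *)
Definition averaging (f : W -> R) := bdd f /\
  forall e, 0 < e -> exists L, forall l, (L <= l)%N ->
    mean (fun x => `|birkhoff f l x - l%:R * mean f|) <= e * l%:R.

Lemma averagingD f g : averaging f -> averaging g -> averaging (fun x => f x + g x).
Proof.
move=> [bf Hf] [bg Hg]; split; first exact: bddD.
move=> e e0; have e2 : 0 < e / 2 by exact: divr_gt0.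
have [L1 H1] := Hf _ e2; have [L2 H2] := Hg _ e2.
exists (maxn L1 L2) => l; rewrite geq_max => /andP[/H1 {}H1 /H2 {}H2].
have bf' := bdd_norm (bdd_discrepancy l bf).
have bg' := bdd_norm (bdd_discrepancy l bg).
apply: (@le_trans _ _ (mean (fun x => `|birkhoff f l x - l%:R * mean f| +
    `|birkhoff g l x - l%:R * mean g|))).
  apply: mean_le; [exact: bdd_norm (bdd_discrepancy l (bddD bf bg))|exact: bddD|].
  move=> x; rewrite meanD// (_ : _ - _ = (birkhoff f l x - l%:R * mean f) +
    (birkhoff g l x - l%:R * mean g)) ?ler_normD//.
  by rewrite /birkhoff big_split /=; ring.
by rewrite meanD// (splitr e) mulrDl lerD.
Qed.

Lemma averagingZ c f : averaging f -> averaging (fun x => c * f x).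
Proof.
move=> [bf Hf]; split; first exact: bddZ.
move=> e e0; have c1 : 0 < `|c| + 1 by rewrite ltr_wpDl.
have [L H] := Hf (e / (`|c| + 1)) (divr_gt0 e0 c1); exists L => l /H {}H.
have bf' := bdd_norm (bdd_discrepancy l bf).
have -> : (fun x => `|birkhoff (fun x => c * f x) l x - l%:R * mean (fun x => c * f x)|) =
    (fun x => `|c| * `|birkhoff f l x - l%:R * mean f|).
  apply/funext => x; rewrite meanZ// -normrM; congr (`|_|).
  by rewrite mulrBr /birkhoff mulr_sumr; ring.
rewrite meanZ//.
apply: (@le_trans _ _ ((`|c| + 1) * mean (fun x => `|birkhoff f l x - l%:R * mean f|))).
  by rewrite ler_wpM2r ?lerDl//; apply: mean_ge0.
apply: le_trans (ler_wpM2l (ltW c1) H) _.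
by rewrite mulrA mulrCA divff ?gt_eqF// mulr1.
Qed.

Lemma averaging0 : averaging (cst 0).
Proof.
split; first exact: bdd_cst.
move=> e e0; exists 0%N => l _.
rewrite (_ : (fun x => _) = cst 0); first by rewrite mean_cst mulr_ge0// ltW.
by apply/funext => x; rewrite mean_cst mulr0 subr0 /birkhoff big1// normr0.
Qed.

Lemma averaging_sum n (f : nat -> W -> R) : (forall i, averaging (f i)) ->
  averaging (fun x => \sum_(i < n) f i x).
Proof.
move=> Hf; elim: n => [|n IH].
  by rewrite (_ : (fun x => _) = cst 0); [exact: averaging0|apply/funext => x; rewrite big_ord0].
have -> : (fun x => \sum_(i < n.+1) f i x) = fun x => \sum_(i < n) f i x + f n x.
  by apply/funext => x; rewrite big_ord_recr.
exact: averagingD.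
Qed.

Hypothesis mixT : forall A B, measurable A -> measurable B ->
  (nu (A `&` iter n T @^-1` B) @[n --> \oo] --> (nu A * nu B)%E).

(* The variance of the Birkhoff sums grows subquadratically because the correlations vanish. *)
Lemma averaging_indic A : measurable A -> averaging (\1_A).
Proof.
move=> mA; have bA := bdd_indic R mA; split=> // e e0.
have mAn n : measurable (iter n T @^-1` A).
  by rewrite -[X in measurable X]setTI; exact: measurable_iter.
set a := mean \1_A; pose f (x : W) : R := \1_A x - a.
have aE : a%:E = nu A by rewrite /a mean_indic// fineK// fin_num_measure.
have a01 : 0 <= a <= 1.
  by rewrite -!lee_fin aE measure_ge0 probability_le1.
have bf : bdd f by apply: bddB => //; exact: bdd_cst.
have f1 x : `|f x| <= 1.
  rewrite /f indicE; move: a01 => /andP[? ?].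
  by case: (x \in A); rewrite /= ?mulr0n ?mulr1n ler_norml; apply/andP; split; lra.
pose c n := mean (fun x => f x * f (iter n T x)).
have c1 n : c n <= 1.
  rewrite -(mean_cst nu 1); apply: mean_le; [exact: bddM bf (bdd_iter n bf)|exact: bdd_cst|].
  move=> x; rewrite (le_trans (ler_norm _))// normrM mulr_ile1//.
have cE n : c n = fine (nu (A `&` iter n T @^-1` A)) - a * a.
  rewrite -mean_indic; last exact: measurableI.
  rewrite /c (_ : (fun x => _) = (fun x => \1_(A `&` iter n T @^-1` A) x -
    a * (\1_A x + (\1_A (iter n T x))) + a * a)); last first.
    apply/funext => x; rewrite /f.
    have -> : \1_(A `&` iter n T @^-1` A) x = \1_A x * \1_A (iter n T x) :> R.
      by rewrite indicI /= !indicE; congr (_ * (nat_of_bool _)%:R); apply/idP/idP; rewrite !inE.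
    by ring.
  have bAn := bdd_iter n bA.
  have bI : bdd (\1_(A `&` iter n T @^-1` A) : W -> R) by apply: bdd_indic; exact: measurableI.
  rewrite (meanD nu (bddB bI (bddZ a (bddD bA bAn))) (bdd_cst W (a * a))) (meanB nu bI (bddZ a (bddD bA bAn))).
  have mAn' : mean (fun x => \1_A (iter n T x)) = a by exact: mean_iter.
  rewrite (meanZ nu _ (bddD bA bAn)) (meanD nu bA bAn) mAn' mean_cst.
  rewrite -[mean (fun x => \1_A x)]/a -[mean (fun x => \1_(_ `&` _) x)]/(mean \1_(A `&` iter n T @^-1` A)).
  by ring.
(* With this value the quadratic part of the variance bound uses half of [e ^+ 2 * l%:R ^+ 2]; the
   linear part fits into the other half once [l] is large. *)
have eta0 : 0 < e ^+ 2 / 4 by rewrite divr_gt0// exprn_gt0.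
set eta := e ^+ 2 / 4 in eta0.
have [n0 cn0] : exists n0, forall n, (n0 <= n)%N -> c n <= eta.
  have := mixT mA mA; rewrite -aE -EFinM => /fine_cvgP[_ /cvgrPdist_le /(_ _ eta0)[n0 _ H]].
  exists n0 => n /H /=; rewrite cE distrC => /(le_trans (ler_norm _)); exact.
have csum l : \sum_(i < l) c (l - i)%N <= n0%:R + l%:R * eta.
  have -> : \sum_(i < l) c (l - i)%N = \sum_(i < l) c i.+1.
    rewrite (reindex_inj rev_ord_inj) /=; apply: eq_bigr => i _.
    by rewrite subKn.
  have -> : n0%:R + l%:R * eta = n0%:R + \sum_(i < l) eta.
    by rewrite sumr_const card_ord mulr_natl.
  (* Correlations before [n0] are bounded by one, later ones by [eta]; the minimum counts the early
     ones met so far, which lets the induction on [l] run. *)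
  suff H : \sum_(i < l) c i.+1 <= (minn n0 l)%:R + \sum_(i < l) eta.
    by rewrite (le_trans H)// lerD2r ler_nat geq_minl.
  elim: l => [|l IH]; first by rewrite !big_ord0 minn0 addr0.
  rewrite !big_ord_recr /=; have [nl|ln] := leqP n0 l.
    move: IH; rewrite (minn_idPl nl) (minn_idPl (leqW nl)).
    by have := cn0 l.+1 (leqW nl); lra.
  move: IH; rewrite (minn_idPr (ltnW ln)) (minn_idPr ln) -natr1.
  by have := c1 l.+1; lra.
pose S := birkhoff f.
have bS l : bdd (S l) by exact: bdd_birkhoff.
pose V l := mean (fun x => S l x * S l x).
have VS l : V l.+1 <= V l + 2 * (n0%:R + l%:R * eta) + 1.
  have bfl := bdd_iter l bf.
  have -> : V l.+1 = V l + 2 * mean (fun x => S l x * f (iter l T x)) +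
      mean (fun x => f (iter l T x) * f (iter l T x)).
    rewrite /V -(meanZ nu _ (bddM (bS l) bfl)) -(meanD nu (bddM (bS l) (bS l)) (bddZ 2 (bddM (bS l) bfl))).
    rewrite -(meanD nu (bddD (bddM (bS l) (bS l)) (bddZ 2 (bddM (bS l) bfl))) (bddM bfl bfl)).
    congr mean; apply/funext => x; rewrite {1 2}/S /birkhoff big_ord_recr /= -/(birkhoff f l x) -/(S l x).
    by ring.
  rewrite lerD//.
    rewrite lerD2l ler_pM2l// (le_trans _ (csum l))// /S /birkhoff.
    rewrite (_ : (fun x => _) = fun x => \sum_(i < l) (f (iter i T x) * f (iter l T x))); last first.
      by apply/funext => x; rewrite mulr_suml.
    rewrite (mean_sum _ _ (fun i => bddM (bdd_iter i bf) bfl)).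
    apply: ler_sum => i _; rewrite /c.
    rewrite -(mean_iter i (bddM bf (bdd_iter (l - i) bf))).
    rewrite le_eqVlt; apply/orP; left; apply/eqP; congr mean; apply/funext => x.
    by rewrite -iterD subnK// ltnW.
  rewrite -(mean_cst nu 1); apply: mean_le; [exact: bddM|exact: bdd_cst|].
  by move=> x; rewrite (le_trans (ler_norm _))// normrM mulr_ile1.
have Vl l : V l <= l%:R * (2 * n0%:R + 1) + 2 * eta * l%:R ^+ 2.
  elim: l => [|l IH].
    rewrite mul0r expr0n /= mulr0 addr0 /V (_ : (fun x => _) = cst 0) ?mean_cst//.
    by apply/funext => x; rewrite /S /birkhoff big_ord0 mul0r.
  rewrite (le_trans (VS l))//.
  have l0 : 0 <= l%:R :> R by rewrite ler0n.
  by rewrite -natr1; nra.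
exists (Num.truncn (2 * (2 * n0%:R + 1) / e ^+ 2)).+1 => l Ll.
have l0 : 0 < l%:R :> R by rewrite ltr0n (leq_trans _ Ll).
have lL : 2 * (2 * n0%:R + 1) <= l%:R * e ^+ 2.
  rewrite -ler_pdivrMr ?exprn_gt0//; apply: (le_trans (ltW (truncnS_gt _))).
  by rewrite ler_nat.
have SE x : birkhoff \1_A l x - l%:R * a = S l x.
  by rewrite /S /birkhoff sumrB sumr_const card_ord mulr_natl.
have el0 : 0 < e * l%:R by exact: mulr_gt0.
(* With [t = e * l%:R], the inequality [2 * t * |S| <= t ^+ 2 + S ^+ 2] turns the variance bound
   into an L^1 bound. *)
apply: (@le_trans _ _ (mean (fun x => e * l%:R / 2 + (2 * (e * l%:R))^-1 * (S l x * S l x)))).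
  apply: mean_le.
  - by apply: bdd_norm; exact: bdd_discrepancy.
  - by apply: bddD; [exact: bdd_cst|apply: bddZ; exact: bddM].
  move=> x; rewrite SE -expr2 -(real_normK (num_real (S l x))).
  set s := `|S l x|; set t := e * l%:R in el0 *.
  rewrite -(@ler_pM2l _ (2 * t)); last by rewrite mulr_gt0.
  have -> : 2 * t * (t / 2 + (2 * t)^-1 * s ^+ 2) = t ^+ 2 + s ^+ 2.
    by field; rewrite gt_eqF.
  by have := sqr_ge0 (t - s); rewrite sqrrB; lra.
rewrite (meanD nu (bdd_cst W (e * l%:R / 2)) (bddZ _ (bddM (bS l) (bS l)))) mean_cst (meanZ nu _ (bddM (bS l) (bS l))).
rewrite -/(V l).
suff : (2 * (e * l%:R))^-1 * V l <= e * l%:R / 2 by lra.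
rewrite ler_pdivrMl ?mulr_gt0//.
apply: (le_trans (Vl l)).
rewrite (_ : 2 * (e * l%:R) * _ = e ^+ 2 * l%:R ^+ 2); last by field.
have : l%:R * (2 * n0%:R + 1) <= l%:R * (l%:R * e ^+ 2 / 2) by rewrite ler_pM2l//; lra.
have : 2 * eta * l%:R ^+ 2 = e ^+ 2 / 2 * l%:R ^+ 2 by rewrite /eta; field.
by nra.
Qed.

End mean_ergodic.

(** * Survival functions and their near constancy *)

Section survival.
Context d (W : measurableType d) (R : realType) (nu : probability W R).
Variable T : W -> W.
Hypothesis mT : measurable_fun setT T.
Hypothesis invT : forall A, measurable A -> nu (T @^-1` A) = nu A.
Local Notation mean := (mean nu).
Local Notation birkhoff := (birkhoff T).

(** The [F_l] of the overview: the conditional probability, given the starting point, of no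
    exceedance during [l] steps. *)
Definition survival (G : W -> R) (l : nat) (x : W) : R :=
  \prod_(i < l) (1 - G (iter i T x)).

Section one_level.
Variables (G : W -> R) (K : R).
Hypothesis mG : measurable_fun setT G.
Hypothesis G01 : forall x, 0 <= G x <= 1.
Local Notation p := (mean G).
Hypothesis GK : forall x, G x <= K * p.

Lemma bdd_rate : bdd G.
Proof.
by split=> //; exists 1 => x; have /andP[? ?] := G01 x; rewrite ger0_norm.
Qed.

Lemma bdd_survival l : bdd (survival G l).
Proof.
exact: (bdd_prod _ (fun i => bddB (bdd_cst W 1) (bdd_iter mT i bdd_rate))).
Qed.

Lemma survival_itv l x : 0 <= survival G l x <= 1.
Proof.
rewrite /survival; elim: l => [|l /andP[IH1 IH2]]; first by rewrite big_ord0 lexx ler01.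
rewrite big_ord_recr /=; have /andP[? ?] := G01 (iter l T x).
by rewrite mulr_ge0 ?subr_ge0//= mulr_ile1 ?subr_ge0// lerBlDr lerDl.
Qed.

Lemma survival_anti l k x : (k <= l)%N -> survival G l x <= survival G k x.
Proof.
move=> /subnK <-; elim: (l - k)%N => [|j IH]; first by rewrite add0n.
rewrite addSn {1}/survival big_ord_recr /= -/(survival G (j + k) x).
apply: le_trans IH; have /andP[? ?] := G01 (iter (j + k) T x).
by rewrite ler_piMr ?lerBlDr ?lerDl//; have /andP[] := survival_itv (j + k) x.
Qed.

(** Two comparisons: the product with the exponential of the Birkhoff sum costs the sum of squares,
    at most [K * p] times the sum itself; replacing the sum by its mean costs their difference, the
    exponential being 1-Lipschitz there. *)
Lemma survival_exp l : mean (fun x => `|survival G l x - expR (- (l%:R * p))|) <=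
  l%:R * p * (K * p) + mean (fun x => `|birkhoff G l x - l%:R * p|).
Proof.
have bG := bdd_rate; have bd := bdd_norm (bdd_discrepancy nu mT l bG).
have bS := bdd_birkhoff mT l bG.
have p0 : 0 <= p by apply: mean_ge0 => x; have /andP[] := G01 x.
have <- : mean (fun x => K * p * birkhoff G l x) = l%:R * p * (K * p).
  by rewrite (meanZ nu _ bS) (mean_birkhoff mT invT l bG) mulrC.
rewrite -(meanD nu (bddZ (K * p) bS) bd); apply: mean_le.
- by apply: bdd_norm; apply: bddB; [exact: bdd_survival|exact: bdd_cst].
- by apply: bddD => //; exact: bddZ.
move=> x; have S0 : 0 <= birkhoff G l x.
  by apply: sumr_ge0 => i _; have /andP[] := G01 (iter i T x).
rewrite -(subrK (expR (- birkhoff G l x)) (survival G l x)) -addrA.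
apply: (le_trans (ler_normD _ _)); apply: lerD; last first.
  by apply: expRN_lipschitz => //; exact: mulr_ge0.
apply: (le_trans (prod_exp_le l (a := fun i => G (iter i T x)) (fun i => G01 _))).
rewrite /birkhoff mulr_sumr; apply: ler_sum => i _; rewrite expr2.
by rewrite ler_wpM2r ?GK//; have /andP[] := G01 (iter i T x).
Qed.

(** In [G = h + b * g] the error [h] enters once through its sums and once through its mean, whence
    the factor 2. *)
Lemma birkhoff_approx (g : W -> R) (b e : R) l : bdd g -> 0 <= b ->
  mean (fun x => `|G x - b * g x|) <= e ->
  mean (fun x => `|birkhoff G l x - l%:R * p|) <=
    2 * (l%:R * e) + b * mean (fun x => `|birkhoff g l x - l%:R * mean g|).
Proof.
move=> bg b0 Ge; have bG := bdd_rate.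
have bh := bddB bG (bddZ b bg); set h := (fun x => G x - b * g x) in bh Ge.
have mh : `|mean h| <= e by exact: le_trans (norm_mean_le nu bh) Ge.
have hE : mean h = p - b * mean g by rewrite (meanB nu bG (bddZ b bg)) (meanZ nu _ bg).
have bn := bdd_norm bh; have bS := bdd_birkhoff mT l bn.
have bd := bdd_norm (bdd_discrepancy nu mT l bg).
have H1 : mean (birkhoff (fun x => `|h x|) l) <= l%:R * e.
  by rewrite (mean_birkhoff mT invT l bn) ler_wpM2l// ler0n.
apply: (@le_trans _ _ (mean (fun x => (birkhoff (fun x => `|h x|) l x + l%:R * e) +
    b * `|birkhoff g l x - l%:R * mean g|))).
  apply: mean_le.
  - exact: bdd_norm (bdd_discrepancy nu mT l bG).
  - by apply: bddD; [apply: bddD => //; exact: bdd_cst|exact: bddZ].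
  move=> x; have -> : birkhoff G l x - l%:R * p = birkhoff h l x - l%:R * mean h +
      b * (birkhoff g l x - l%:R * mean g).
    rewrite hE; have -> : birkhoff G l x = birkhoff h l x + b * birkhoff g l x.
      by rewrite /birkhoff mulr_sumr -big_split /=; apply: eq_bigr => i _; rewrite /h subrK.
    by ring.
  rewrite (le_trans (ler_normD _ _))// lerD//; last by rewrite normrM ger0_norm.
  rewrite (le_trans (ler_normB _ _))// lerD//; first exact: ler_norm_sum.
  by rewrite normrM ger0_norm ?ler0n// ler_wpM2l ?ler0n.
rewrite (meanD nu (bddD bS (bdd_cst W (l%:R * e))) (bddZ b bd)) (meanZ nu _ bd).
rewrite (meanD nu bS (bdd_cst W (l%:R * e))) mean_cst lerD2r.
by rewrite mulr2n mulrDl mul1r lerD2r.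
Qed.

(** Crude bound for blocks too short for the ergodic theorem. *)
Lemma birkhoff_discrepancy_le (g : W -> R) (M : R) l : measurable_fun setT g ->
  (forall x, `|g x| <= M) ->
  mean (fun x => `|birkhoff g l x - l%:R * mean g|) <= 2 * l%:R * M.
Proof.
move=> mg gM; have bg : bdd g by split=> //; exists M.
rewrite -(mean_cst nu (2 * l%:R * M)); apply: mean_le.
- exact: bdd_norm (bdd_discrepancy nu mT l bg).
- exact: bdd_cst.
move=> x; rewrite (le_trans (ler_normB _ _))//.
have -> : 2 * l%:R * M = l%:R * M + l%:R * M by ring.
rewrite lerD//.
  rewrite (le_trans (ler_norm_sum _ _ _))// (le_trans (ler_sum _ (fun i _ => gM _)))//.
  by rewrite sumr_const card_ord mulr_natl.
rewrite normrM ger0_norm ?ler0n// ler_wpM2l ?ler0n// (le_trans (norm_mean_le nu bg))//.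
by rewrite -(mean_cst nu M); apply: mean_le;
  [exact: bdd_norm|exact: bdd_cst|exact: gM].
Qed.

(** Subtracting [c] from the survival function leaves the covariance unchanged; the bound on [G] and
    the invariance of [nu] then give an estimate uniform in [t]. *)
Lemma mixing_estimate (l t : nat) (c e : R) :
  mean (fun x => `|survival G l x - c|) <= e ->
  `|mean (fun x => G x * survival G l (iter t T x)) - p * mean (survival G l)|
    <= (K + 1) * p * e.
Proof.
move=> He; have bG := bdd_rate; have bF := bdd_survival l.
have p0 : 0 <= p by apply: mean_ge0 => x; have /andP[] := G01 x.
have bc : bdd (fun x => survival G l x - c) by apply: bddB => //; exact: bdd_cst.
have bt := bdd_iter mT t bc.
have -> : mean (fun x => G x * survival G l (iter t T x)) - p * mean (survival G l) =
   mean (fun x => G x * (survival G l (iter t T x) - c)) -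
   p * mean (fun x => survival G l x - c).
  rewrite (meanB nu bF (bdd_cst W c)) mean_cst.
  have -> : (fun x => G x * (survival G l (iter t T x) - c)) =
     (fun x => G x * survival G l (iter t T x) - c * G x).
    by apply/funext => x; ring.
  by rewrite (meanB nu (bddM bG (bdd_iter mT t bF)) (bddZ c bG)) (meanZ nu _ bG); ring.
rewrite (le_trans (ler_normB _ _))//.
have -> : (K + 1) * p * e = K * p * e + p * e by ring.
rewrite lerD//; last first.
  by rewrite normrM ger0_norm// ler_wpM2l// (le_trans (norm_mean_le nu bc)).
rewrite (le_trans (norm_mean_le nu (bddM bG bt)))//.
apply: (@le_trans _ _ (mean (fun x => K * p * `|survival G l (iter t T x) - c|))).
  apply: mean_le; [exact: bdd_norm (bddM bG bt)|exact: bddZ (bdd_norm bt)|].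
  move=> x; have /andP[? ?] := G01 x.
  by rewrite normrM ger0_norm// ler_wpM2r.
rewrite (meanZ nu _ (bdd_norm bt)) (mean_iter mT invT t (bdd_norm bc)).
apply: ler_wpM2l => //.
have x0 : W := point.
by have /andP[? ?] := G01 x0; exact: le_trans (GK x0).
Qed.

End one_level.

Variables (G : nat -> W -> R) (K tau : R).
Hypothesis mG : forall m, measurable_fun setT (G m).
Hypothesis G01 : forall m x, 0 <= G m x <= 1.
Hypothesis GK : forall m x, G m x <= K * mean (G m).
Hypothesis K0 : 0 <= K.
Hypothesis tau0 : 0 < tau.
Hypothesis mp : m%:R * mean (G m) @[m --> \oo] --> tau.
(** The function [g] may depend on [e] but not on the level, which acts only through the scalar
    [b m]. *)
Hypothesis GA : forall e, 0 < e -> exists (g : W -> R) (b : nat -> R),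
  averaging nu T g /\ \forall m \near \oo, [/\ 0 <= b m, b m <= K * mean (G m) &
    mean (fun x => `|G m x - b m * g x|) <= e * mean (G m)].

Lemma mean_level_ge0 m : 0 <= mean (G m).
Proof. by apply: mean_ge0 => x; have /andP[] := G01 m x. Qed.

Lemma mean_level_small e : 0 < e -> \forall m \near \oo, mean (G m) <= e.
Proof.
move=> e0; have mp1 : \forall m \near \oo, m%:R * mean (G m) <= tau + 1.
  by apply: (cvgr_le tau) => //; rewrite ltrDl.
near=> m.
have m0 : 0 < m%:R :> R by rewrite ltr0n; near: m; exact: nbhs_infty_gt.
rewrite -(ler_pM2l m0); apply: (@le_trans _ _ (tau + 1)); first by near: m.
rewrite -ler_pdivrMr//.
by near: m; exact: nbhs_infty_ger.
Unshelve. all: by end_near. Qed.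

(** The constant is [expR (- (l%:R * p))] for [l] up to a multiple of [m], and zero beyond, where
    survival is already unlikely. The admissible [m] are found before [l] is given. *)
Lemma survival_near_constant e : 0 < e -> \forall m \near \oo, forall l, exists c,
  mean (fun x => `|survival (G m) l x - c|) <= e.
Proof.
move=> e0.
(* Since [m * p >= tau / 2] eventually, a block of length [L * m] expects at least [2 / e]
   exceedances; [H] bounds the expected number for all shorter blocks. *)
pose L := (Num.truncn (4 / (tau * e))).+1; pose H := L%:R * (tau + 1).
have L0 : 0 < L%:R :> R by [].
have te : 0 < tau * e by exact: mulr_gt0.
have H0 : 0 < H by rewrite mulr_gt0// ltr_wpDl// ltW.
have K1 : 0 < K + 1 by rewrite ltr_wpDl.
have e1 : 0 < e / (8 * H) by rewrite divr_gt0// mulr_gt0.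
have e2 : 0 < e / (8 * H * (K + 1)) by rewrite divr_gt0// mulr_gt0// mulr_gt0.
have [g [b [[[mg [M gM]] /(_ _ e2)[L1 HL1]] GA1]]] := GA e1.
have M0 : 0 <= M by have := gM point; exact: le_trans.
(* Bounds the discrepancy of [g] over blocks shorter than the ergodic threshold [L1]. *)
pose Q := 2 * L1%:R * M + 1.
have Q0 : 0 < Q by rewrite ltr_wpDl// !mulr_ge0.
have p1 : \forall m \near \oo, mean (G m) <= e / (8 * H * (K + 1)).
  exact: mean_level_small.
have p2 : \forall m \near \oo, mean (G m) <= e / (8 * Q * (K + 1)).
  by apply: mean_level_small; rewrite divr_gt0// mulr_gt0// mulr_gt0.
have mp1 : \forall m \near \oo, m%:R * mean (G m) <= tau + 1.
  by apply: (cvgr_le tau) => //; rewrite ltrDl.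
have mp2 : \forall m \near \oo, tau / 2 <= m%:R * mean (G m).
  by apply: (cvgr_ge tau) => //; rewrite ltr_pdivrMr// ltr_pMr// ltr1n.
near=> m.
have [b0 bK Gb] : [/\ 0 <= b m, b m <= K * mean (G m) &
    mean (fun x => `|G m x - b m * g x|) <= e / (8 * H) * mean (G m)] by near: m.
have q1 : mean (G m) <= e / (8 * H * (K + 1)) by near: m.
have q2 : mean (G m) <= e / (8 * Q * (K + 1)) by near: m.
have mq1 : m%:R * mean (G m) <= tau + 1 by near: m.
have mq2 : tau / 2 <= m%:R * mean (G m) by near: m.
have p0 := mean_level_ge0 m.
set p := mean (G m) in b0 bK Gb q1 q2 mq1 mq2 p0.
have short l : (l <= L * m)%N ->
    mean (fun x => `|survival (G m) l x - expR (- (l%:R * p))|) <= e / 2.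
  move=> lLm.
  have lp0 : 0 <= l%:R * p by exact: mulr_ge0.
  have lp : l%:R * p <= H.
    apply: (@le_trans _ _ ((L * m)%:R * p)); first by rewrite ler_wpM2r// ler_nat.
    by rewrite natrM -mulrA ler_pM2l.
  apply: (le_trans (survival_exp (mG m) (G01 m) (GK m) l)).
  have bg : bdd g by split=> //; exists M.
  have := birkhoff_approx (mG m) (G01 m) l bg b0 Gb; rewrite -/p.
  set D := mean (fun x => `|birkhoff g l x - _|); set D' := mean _ => HD'.
  (* Three errors of size [e / 8], the second of which counts twice, make [e / 2]. *)
  have A1 : l%:R * p * (K * p) <= e / 8.
    apply: (@le_trans _ _ (H * ((K + 1) * (e / (8 * H * (K + 1)))))).
      apply: ler_pM => //; first exact: mulr_ge0.
      by apply: ler_pM => //; rewrite lerDl.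
    rewrite le_eqVlt; apply/orP; left; apply/eqP; field.
    by rewrite !gt_eqF.
  have A2 : l%:R * (e / (8 * H) * p) <= e / 8.
    rewrite mulrCA (_ : e / 8 = e / (8 * H) * H); first by rewrite ler_pM2l.
    by field; rewrite gt_eqF.
  have A3 : b m * D <= e / 8.
    have D0 : 0 <= D by apply: mean_ge0.
    apply: (@le_trans _ _ ((K + 1) * p * D)).
      by rewrite ler_wpM2r// (le_trans bK)// ler_wpM2r// lerDl.
    (* Beyond [L1] the ergodic theorem applies; below it the crude bound is multiplied by [p], which
       is small. *)
    have [/HL1 lL1|lL1] := leqP L1 l.
      apply: (@le_trans _ _ ((K + 1) * p * (e / (8 * H * (K + 1)) * l%:R))).
        by rewrite ler_wpM2l// mulr_ge0// ltW.
      have -> : (K + 1) * p * (e / (8 * H * (K + 1)) * l%:R) = e / (8 * H) * (l%:R * p).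
        by field; rewrite !gt_eqF.
      rewrite (_ : e / 8 = e / (8 * H) * H); first by rewrite ler_pM2l.
      by field; rewrite gt_eqF.
    have DQ : D <= Q.
      apply: (le_trans (birkhoff_discrepancy_le l mg gM)).
      rewrite (@le_trans _ _ (2 * L1%:R * M))// ?lerDl//.
      by rewrite ler_wpM2r// ler_pM2l// ler_nat ltnW.
    apply: (@le_trans _ _ ((K + 1) * (e / (8 * Q * (K + 1))) * Q)).
      apply: ler_pM => //; first by rewrite mulr_ge0// ltW.
      by rewrite ler_pM2l.
    rewrite le_eqVlt; apply/orP; left; apply/eqP; field.
    by rewrite !gt_eqF.
  by lra.
move=> l; have [lLm|Lml] := leqP l (L * m).
  by exists (expR (- (l%:R * p))); rewrite (le_trans (short l lLm))//; lra.
(* Survival decreases with the block length, so its value at [n] is enough; there both the error and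
   the exponential are at most [e / 2]. *)
exists 0; pose n := (L * m)%N.
have bF k := bdd_survival (mG m) (G01 m) k.
apply: (@le_trans _ _ (mean (fun x => `|survival (G m) n x - expR (- (n%:R * p))| +
    expR (- (n%:R * p))))).
  apply: mean_le.
  - by apply: bdd_norm; apply: bddB; [exact: bF|exact: bdd_cst].
  - apply: bddD; last exact: bdd_cst.
    by apply: bdd_norm; apply: bddB; [exact: bF|exact: bdd_cst].
  move=> x; rewrite subr0 ger0_norm; last by have /andP[] := survival_itv (G01 m) l x.
  rewrite (le_trans (survival_anti (G01 m) x (ltnW Lml)))//.
  by rewrite -lerBlDr ler_norm.
have bd : bdd (fun x => `|survival (G m) n x - expR (- (n%:R * p))|).
  by apply: bdd_norm; apply: bddB; [exact: bF|exact: bdd_cst].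
rewrite (meanD nu bd (bdd_cst W (expR (- (n%:R * p))))) mean_cst [leRHS]splitr lerD//; first exact: short.
have np : 2 / e <= n%:R * p.
  rewrite /n natrM -mulrA (@le_trans _ _ (L%:R * (tau / 2)))//; last by rewrite ler_pM2l.
  have : 4 / (tau * e) < L%:R by exact: truncnS_gt.
  rewrite ltr_pdivrMr// => L4; rewrite ler_pdivrMr//.
  by lra.
have np0 : 0 < n%:R * p by rewrite (lt_le_trans _ np)// divr_gt0.
rewrite expRN -[leRHS]invrK invf_div lef_pV2 ?posrE ?expR_gt0 ?divr_gt0//.
by rewrite (le_trans np)// (le_trans _ (expR_ge1Dx _))// lerDr.
Unshelve. all: by end_near. Qed.

Lemma asymptotic_independence e : 0 < e -> \forall m \near \oo, forall l t,
  `|mean (fun x => G m x * survival (G m) l (iter t T x))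
    - mean (G m) * mean (survival (G m) l)| <= e * mean (G m).
Proof.
move=> e0; have K1 : 0 < K + 1 by rewrite ltr_wpDl.
have := survival_near_constant (divr_gt0 e0 K1); apply: filterS => m Hm l t.
have [c Hc] := Hm l.
apply: (le_trans (mixing_estimate (mG m) (G01 m) (GK m) t Hc)).
by rewrite le_eqVlt; apply/orP; left; apply/eqP; field; rewrite gt_eqF.
Qed.

End survival.

(** * The law of the perturbed target *)

Section noise_law.
Variables (R : realType) (d : nat) (N : vnorm R d) (theta : probability (noise N) R).
Variables (a : 'rV[R]_d) (eps : R).
Local Notation Omega := (torus R d).
Local Notation Leb := (@lebesgue_torus R d).

(** Moving the noise from the orbit to the target: the noisy observation is close to the projection
    of [a] exactly when the orbit point is close to [target], whose law is the same at all times. *)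
Definition target (s : noise N) : Omega := to_torus (a - eps *: noise_val s).

Lemma measurable_target_row : measurable_fun setT (fun v : 'rV[R]_d => to_torus (a - eps *: v) : Omega).
Proof.
apply: measurable_torus_fun => U; rewrite open_torusE => oU; apply: open_measurable_rV.
rewrite (_ : _ @^-1` _ = (fun v => a + (- eps) *: v) @^-1` (@to_torus R d @^-1` U)).
  by have /continuousP := @row_affine_continuous R d a (- eps); exact.
by apply/seteqP; split=> v /=; rewrite scaleNr.
Qed.

Lemma measurable_noise_val : measurable_fun setT (@noise_val R d N).
Proof. by move=> _ B mB; rewrite setTI; exists B => //; rewrite setTI. Qed.

Lemma measurable_target : measurable_fun setT target.
Proof. exact: (measurableT_comp measurable_target_row measurable_noise_val). Qed.

Lemma Lfun_infty_bounded dd (X : measurableType dd) (mu : {measure set X -> \bar R})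
    (f : X -> R) : f \in Lfun mu +oo%E ->
  measurable_fun setT f /\ exists2 M, 0 <= M & {ae mu, forall x, `|f x| <= M}.
Proof.
move=> fL; split; first exact: (set_mem (sub_Lfun_mfun fL)).
have : ('N[mu]_+oo[EFin \o f] < +oo)%E by exact: (set_mem (sub_Lfun_finLfun fL)).
(* The essential norm is defined by cases on whether the space has positive mass; in a null space
   every bound holds almost everywhere. *)
rewrite unlock; case: ifPn => [_|mu0 _]; last first.
  have muT : mu setT = 0%E by apply/eqP; rewrite eq_le measure_ge0 andbT leNgt.
  by exists 0 => //; exists setT; split.
have := ess_sup_ge mu (abse \o (EFin \o f)).
set E := ess_sup _ _ => fE Eoo.
have [M M0 EM] : exists2 M, 0 <= M & (E <= M%:E)%E.
  move: Eoo; case: E {fE} => [r _|//|_]; last by exists 0; rewrite ?leNye.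
  by exists `|r| => //; rewrite lee_fin ler_norm.
exists M => //; apply: filterS fE => x /= fx.
by rewrite -lee_fin; exact: le_trans fx EM.
Qed.

(** An almost everywhere bound on [rho] is multiplied by the covering bound for the affine image.
    Absolute values occur because [rho] is not assumed pointwise nonnegative. *)
Lemma noise_law_le (rho : 'rV[R]_d -> R) : 0 < eps ->
  rho \in Lfun (@lebesgue_rV R d) +oo%E ->
  (forall A : set 'rV[R]_d, measurable A -> theta (@noise_val R d N @^-1` A)
          = (\int[@lebesgue_rV R d]_(v in A `&` noise_ball N) (rho v)%:E)%E) ->
  exists2 K, 0 <= K & forall A, measurable A ->
    (theta (target @^-1` A) <= K%:E * Leb A)%E.
Proof.
move=> e0 /Lfun_infty_bounded[mrho [M M0 rhoM]] thetaE.
have [K K0 HK] := lebesgue_affine_image_le N a e0.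
exists (M * K) => [|A mA]; first exact: mulr_ge0.
pose B := (fun v : 'rV[R]_d => to_torus (a - eps *: v) : Omega) @^-1` A.
have mB : measurable B by exact: (torus_preimage_measurable measurable_target_row mA).
have mBN : measurable (B `&` noise_ball N).
  by apply: measurableI => //; exact: measurable_noise_ball.
have mr : measurable_fun (B `&` noise_ball N) (EFin \o rho).
  by apply: measurable_funTS; apply/measurable_EFinP.
rewrite (_ : target @^-1` A = @noise_val R d N @^-1` B)// thetaE//.
rewrite (le_trans (lee_abs _))// (le_trans (le_abse_integral _ mBN mr))//.
apply: (@le_trans _ _ (M%:E * @lebesgue_rV R d (B `&` noise_ball N))%E).
  apply: integral_le_bound => //.
  by apply: filterS rhoM => v rv _; rewrite lee_fin.
by rewrite EFinM -muleA lee_wpmul2l//; exact: HK.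
Qed.

End noise_law.

(** * Conditional independence given the starting point, and block maxima *)

Section noisy_orbit.
Context (R : realType) d1 d2 (W : measurableType d1) (E : measurableType d2).
Variables (nu : probability W R) (theta : probability E R).
Variable (Theta : probability (seq_space E) R).
Hypothesis productTheta : is_product_law theta Theta.

(** The product measure integrates over [x] the [Theta]-measure of the section, and each section is
    a measurable rectangle, on which the product law factorises. *)
Lemma prob_sections n (I : nat -> W -> set E) (q : nat -> W -> R) :
  (forall i x, measurable (I i x)) -> (forall i x, theta (I i x) = (q i x)%:E) ->
  prob (nu \x Theta)%E [set w : W * seq_space E | forall i : 'I_n, I i w.1 (w.2 i)] =
  mean nu (fun x => \prod_(i < n) q i x).
Proof.
move=> mI qE; rewrite /prob /mean /Rintegral; congr fine.
apply: eq_integral => x _ /=.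
rewrite (_ : xsection _ x = [set xi : seq_space E | forall i : 'I_n, I i x (xi i)]).
  rewrite (productTheta (fun i => mI i x)) -prodEFin; apply: eq_bigr => i _.
  exact: qE.
by apply/seteqP; split=> xi; rewrite /xsection /= inE.
Qed.

End noisy_orbit.

Section block_max_theory.
Context (R : realType) d (W : measurableType d) (X : nat -> W -> \bar R).

Lemma block_belowE t l u :
  block_below X t l u = [set w | forall i, (t <= i < t + l)%N -> ~ exceeds X i u w].
Proof.
apply/seteqP; split=> w; rewrite /block_below /exceeds /block_max /=.
  move=> H i iP; apply/negP; rewrite -leNgt; apply: le_trans H.
  elim: l iP => [|l IH]; first by rewrite addn0; lia.
  rewrite addnS big_nat_recr /= ?leq_addr// le_max => /andP[ti].
  by rewrite ltnS leq_eqVlt => /orP[/eqP ->|il]; rewrite ?lexx ?orbT// IH// ti il.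
elim: l => [|l IH] H; first by rewrite addn0 big_geq// leNye.
rewrite addnS big_nat_recr /= ?leq_addr// ge_max IH => [|i /andP[ti il]]; last first.
  by apply: H; rewrite ti addnS ltnS ltnW.
rewrite leNgt; apply/negP; apply: H.
by rewrite addnS leqnn leq_addr.
Qed.

End block_max_theory.

Lemma tnorm_ge0 (R : realType) d (N : vnorm R d) (x : torus R d) : 0 <= tnorm N x.
Proof.
have [v vx] := to_torus_surj x.
apply: lb_le_inf => [|_ [w _ <-]]; last exact: vnorm_ge0.
by exists (N v); exists v.
Qed.

Lemma exceeds_noisy (R : realType) d (N : vnorm R d) (T : torus R d -> torus R d)
    (eps : R) (a : 'rV[R]_d) (j : nat) (u : R) (w : torus R d * seq_space (noise N)) :
  exceeds (noisy_process T eps (to_torus a)) j u w <->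
  near_set N (expR (- u)) (iter j T w.1) (target a eps (w.2 j)).
Proof.
rewrite /exceeds /noisy_process /near_set /tball /target /= to_torusB.
rewrite opprB addrA; set x := tnorm _ _.
have x0 : 0 <= x by exact: tnorm_ge0.
(* At distance zero the observable is [+oo] and exceeds every level, in agreement with
   [0 < expR (- u)]. *)
rewrite /lne; case: ifPn => [x0'|].
  have -> : x = 0 by apply/eqP; rewrite eq_le x0' x0.
  by split=> _; [exact: expR_gt0|exact: ltry].
rewrite -ltNge => xgt0; rewrite -EFinN lte_fin ltrNr.
by rewrite -{2}(lnK xgt0) ltr_expR.
Qed.

Section noise_distribution.
Variables (R : realType) (d : nat) (N : vnorm R d) (theta : probability (noise N) R).
Variables (a : 'rV[R]_d) (eps : R).

HB.instance Definition _ := isMeasurableFun.Build _ _ _ _ (@target R d N a eps)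
  (@measurable_target R d N a eps).

Definition target_law : probability (torus R d) R := distribution theta (@target R d N a eps).



End noise_distribution.

(** * Sufficient criteria for the two conditions *)

Section extreme_conditions.
Variables (R : realType) (disp : measure_display) (W : measurableType disp).
Variables (P : probability W R) (X : nat -> W -> \bar R) (u : nat -> R) (tau : R).
Hypothesis mX : forall j v, measurable (exceeds X j v).
Local Notation p m := (prob P (exceeds X 0 (u m))).
Hypothesis mp : m%:R * p m @[m --> \oo] --> tau.

Lemma prob_ge0 A : 0 <= prob P A.
Proof. exact: fine_ge0. Qed.

Lemma prob_le1 A : measurable A -> prob P A <= 1.
Proof. by move=> mA; rewrite -lee_fin fineK ?fin_num_measure// probability_le1. Qed.

Lemma measurable_block_below t l v : measurable (block_below X t l v).
Proof.
rewrite block_belowE.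
rewrite (_ : [set _ | _] = \bigcap_i (if (t <= i < t + l)%N then ~` exceeds X i v else setT)).
  by apply: bigcapT_measurable => i; case: ifP => // _; exact: measurableC.
apply/seteqP; split=> w /= H i; first by move=> _; case: ifP => // il; exact: H.
by move=> il; have := H i Logic.I; rewrite il.
Qed.

Definition dependence m t l := `| prob P (exceeds X 0 (u m) `&` block_below X t l (u m))
  - p m * prob P (block_below X 0 l (u m)) |.

Lemma dependence_le1 m t l : dependence m t l <= 1.
Proof.
have mE := mX 0 (u m).
have mB t' := measurable_block_below t' l (u m).
have := prob_le1 (measurableI _ _ mE (mB t)); have := prob_le1 mE; have := prob_le1 (mB 0%N).
have := prob_ge0 (exceeds X 0 (u m) `&` block_below X t l (u m)).
have := prob_ge0 (exceeds X 0 (u m)); have := prob_ge0 (block_below X 0 l (u m)).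
rewrite /dependence ler_norml => *; apply/andP; split; nra.
Qed.

Lemma cvg_one_over : (1%N%:R / m%:R : R) @[m --> \oo] --> (0 : R).
Proof.
apply/cvgr0Pnorm_le => e e0; near=> m.
have m0 : 0 < m%:R :> R by rewrite ltr0n; near: m; exact: nbhs_infty_gt.
rewrite ger0_norm ?divr_ge0 ?ler0n// ler_pdivrMr// mulrC -ler_pdivrMr//.
by near: m; exact: nbhs_infty_ger.
Unshelve. all: by end_near. Qed.

(** The rate is the supremum of [dependence] over all block lengths and positive gaps, finite
    because [dependence] is at most one; hence it is constant in [t] from [1] on. *)
Lemma condition_D2_of :
  (forall e, 0 < e -> \forall m \near \oo, forall t l, dependence m t.+1 l <= e * p m) ->
  condition_D2 P X u (fun=> 1%N).
Proof.
move=> H; pose S m := [set x | exists tl, dependence m tl.1.+1 tl.2 = x].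
have S0 m : S m !=set0 by exists (dependence m 1 0), (0%N, 0%N).
have Sub m : has_ubound (S m) by exists 1 => _ [tl <-]; exact: dependence_le1.
pose Gam m := sup (S m).
have Gam_ge m t l : dependence m t.+1 l <= Gam m.
  by apply: ub_le_sup => //; exists (t, l).
have Gam0 m : 0 <= Gam m by rewrite (le_trans _ (Gam_ge m 0 0))%N// normr_ge0.
(* At [t = 0] the block contains time zero itself; the trivial bound is used there, enlarged by
   [Gam m] to keep the rate decreasing. *)
exists (fun m t => if t is 0%N then 1 + Gam m else Gam m); split.
- move=> l [|t] m; last exact: Gam_ge.
  by apply: le_trans (dependence_le1 m 0 l) _; rewrite lerDl.
- by move=> m [|t] [|t'] //= _; rewrite lerDr.
- exact: cvg_one_over.
- have tau1 : 0 < `|tau| + 1 by rewrite ltr_wpDl.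
  apply/cvgr0Pnorm_le => e e0.
  have mp1 : \forall m \near \oo, m%:R * p m <= `|tau| + 1.
    apply: (cvgr_le tau) => //; apply: (le_lt_trans (ler_norm _)).
    by rewrite ltrDl.
  have := H _ (divr_gt0 e0 tau1).
  apply: filterS2 mp1 => m mp1 Hm.
  rewrite ger0_norm ?mulr_ge0//.
  have GamS : Gam m <= e / (`|tau| + 1) * p m by apply: ge_sup => // _ [tl <-]; exact: Hm.
  apply: (@le_trans _ _ (m%:R * (e / (`|tau| + 1) * p m))); first by rewrite ler_wpM2l.
  rewrite mulrCA -ler_pdivlMl ?divr_gt0//.
  by rewrite invf_div divfK ?gt_eqF.
Qed.

(** The integer square root serves as [k m]: it tends to infinity and is [o(m)]. *)
Definition sqrt_floor m := \max_(i < m.+1 | (i * i <= m)%N) i.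

Lemma sqrt_floor_sqr m : (sqrt_floor m * sqrt_floor m <= m)%N.
Proof.
rewrite /sqrt_floor; apply: (big_ind (fun n => n * n <= m)%N) => //.
by move=> x y xm ym; rewrite /maxn; case: ifP.
Qed.

Lemma sqrt_floor_ge n m : (n * n <= m)%N -> (n <= sqrt_floor m)%N.
Proof.
move=> nm; have nm1 : (n < m.+1)%N by rewrite ltnS; nia.
exact: (@leq_bigmax_cond _ (fun i : 'I_m.+1 => (i * i <= m)%N) (fun i => i) (Ordinal nm1)).
Qed.

(** There are at most [m / k] terms of size [K * p ^+ 2], so the whole is at most
    [K * (m * p) ^+ 2 / k], where [m * p] stays bounded. *)
Lemma condition_D'_of (K : R) : 0 <= K ->
  (forall m j, prob P (exceeds X 0 (u m) `&` exceeds X j.+1 (u m)) <= K * p m * p m) ->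
  condition_D' P X u (fun=> 1%N).
Proof.
move=> K0 H.
have kinf : sqrt_floor m @[m --> \oo] --> \oo.
  apply/cvgnyPge => n; near=> m; apply: sqrt_floor_ge; near: m.
  exact: nbhs_infty_ge.
have kbig (c : R) : \forall m \near \oo, c <= (sqrt_floor m)%:R.
  move/cvgnyPge : kinf => /(_ (Num.truncn c).+1); apply: filterS => m km.
  by rewrite ltW// (lt_le_trans (truncnS_gt _))// ler_nat.
have kpos : \forall m \near \oo, 0 < (sqrt_floor m)%:R :> R.
  by have := kbig 1; apply: filterS => m; exact: lt_le_trans.
exists sqrt_floor; split => //.
  apply/cvgr0Pnorm_le => e e0; near=> m.
  have k0 : 0 < (sqrt_floor m)%:R :> R by near: m.
  have kk : (sqrt_floor m)%:R * (sqrt_floor m)%:R <= m%:R :> R.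
    by rewrite -natrM ler_nat sqrt_floor_sqr.
  have m0 : 0 < m%:R :> R by rewrite (lt_le_trans _ kk)// mulr_gt0.
  rewrite muln1 ger0_norm ?divr_ge0// ler_pdivrMr//.
  rewrite -(ler_pM2l k0) (le_trans kk)// mulrA ler_pMl//.
  by rewrite -ler_pdivrMr//; near: m; exact: kbig.
have tau1 : 0 < `|tau| + 1 by rewrite ltr_wpDl.
have mp1 : \forall m \near \oo, m%:R * p m <= `|tau| + 1.
  apply: (cvgr_le tau) => //; apply: (le_lt_trans (ler_norm _)).
  by rewrite ltrDl.
apply/cvgr0Pnorm_le => e e0; near=> m.
have k0 : 0 < (sqrt_floor m)%:R :> R by near: m.
rewrite ger0_norm; last by rewrite mulr_ge0// sumr_ge0// => j _; exact: prob_ge0.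
pose q := (m %/ sqrt_floor m)%N.
have qk : q%:R * (sqrt_floor m)%:R <= m%:R :> R by rewrite -natrM ler_nat leq_divM.
have pm0 : 0 <= p m by exact: prob_ge0.
have -> : \sum_(1 <= j < q.+1) prob P (exceeds X 0 (u m) `&` exceeds X j (u m)) =
    \sum_(j < q) prob P (exceeds X 0 (u m) `&` exceeds X j.+1 (u m)).
  by rewrite big_add1 big_mkord.
apply: (@le_trans _ _ (m%:R * (q%:R * (K * p m * p m)))).
  rewrite ler_wpM2l// (_ : q%:R * _ = \sum_(j < q) (K * p m * p m)); first exact: ler_sum.
  by rewrite sumr_const card_ord mulr_natl.
rewrite -(ler_pM2r k0).
have -> : m%:R * (q%:R * (K * p m * p m)) * (sqrt_floor m)%:R =
   K * (m%:R * p m) * (q%:R * (sqrt_floor m)%:R * p m) by ring.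
apply: (@le_trans _ _ (K * (`|tau| + 1) * (`|tau| + 1))).
  have mpm : m%:R * p m <= `|tau| + 1 by near: m.
  apply: ler_pM; rewrite ?mulr_ge0//; first by rewrite ler_wpM2l.
  by rewrite (le_trans _ mpm)// ler_wpM2r.
by rewrite -ler_pdivrMl//; near: m; exact: kbig.
Unshelve. all: by end_near. Qed.

End extreme_conditions.

(** * Application to the noisy process *)

Section noisy_process_theory.
Variables (R : realType) (d : nat) (N : vnorm R d) (T : torus R d -> torus R d).
Variables (nu : probability (torus R d) R) (theta : probability (noise N) R).
Variables (Theta : probability (seq_space (noise N)) R) (eps : R) (a : 'rV[R]_d).
Local Notation Omega := (torus R d).
Local Notation W := (Omega * seq_space (noise N))%type.
Local Notation Leb := (@lebesgue_torus R d).
Hypothesis mT : measurable_fun setT T.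
Hypothesis invT : forall A, measurable A -> nu (T @^-1` A) = nu A.
Hypothesis productTheta : is_product_law theta Theta.

Let P : probability W R := (nu \x Theta)%E.
Let X : nat -> W -> \bar R := noisy_process T eps (to_torus a).
Let kap := target_law theta a eps.
Let G (v : R) : Omega -> R := hit N kap (expR (- v)).
Let ball_at (v : R) (x : Omega) : set (noise N) :=
  target a eps @^-1` near_set N (expR (- v)) x.

Let mball v x : measurable (ball_at v x).
Proof.
apply: (torus_preimage_measurable (@measurable_target R d N a eps)).
exact: measurable_near_set.
Qed.

Let theta_ball v x : theta (ball_at v x) = (G v x)%:E.
Proof. by rewrite /G hitE. Qed.

Let theta_ballC v x : theta (~` ball_at v x) = (1 - G v x)%:E.
Proof. by rewrite probability_setC// theta_ball. Qed.

Lemma measurable_exceeds j v : measurable (exceeds X j v).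
Proof.
rewrite (_ : exceeds X j v = (fun w : W => (iter j T w.1, target a eps (w.2 j))) @^-1`
    near_pairs N (expR (- v))); last by apply/seteqP; split=> w /exceeds_noisy.
rewrite -[X in measurable X]setTI.
have mf : measurable_fun setT (fun w : W => (iter j T w.1, target a eps (w.2 j))).
  apply: measurable_fun_pair.
    exact: (measurableT_comp (measurable_iter mT j) measurable_fst).
  have mj : measurable_fun setT (fun xi : seq_space (noise N) => xi j).
    move=> _ B mB; rewrite setTI; apply: sub_sigma_algebra.
    by exists j, B.
  exact: (measurableT_comp (measurableT_comp (@measurable_target R d N a eps) mj) measurable_snd).
by apply: mf => //; exact: measurable_near_pairs.
Qed.

Let signed (s : nat -> option bool) v i x : set (noise N) :=
  if s i is Some b then (if b then ball_at v (iter i T x) else ~` ball_at v (iter i T x))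
  else setT.

Let factor (s : nat -> option bool) v i x : R :=
  if s i is Some b then (if b then G v (iter i T x) else 1 - G v (iter i T x)) else 1.

(* [s i] prescribes whether the level is exceeded at time [i]; [None] leaves it free *)
Lemma prob_pattern n (s : nat -> option bool) v (A : set W) :
  (forall w, A w <-> forall i, (i < n)%N -> if s i is Some b then
     (if b then exceeds X i v w else ~ exceeds X i v w) else True) ->
  prob P A = mean nu (fun x => \prod_(i < n) factor s v i x).
Proof.
move=> H; have -> : A = [set w : W | forall i : 'I_n, signed s v i w.1 (w.2 i)].
  apply/seteqP; split=> w.
    move=> /H Hw i; have := Hw i (ltn_ord i); rewrite /signed.
    by case: (s i) => // -[/exceeds_noisy //|nE nB]; apply: nE; exact/exceeds_noisy.
  move=> /= Hw; apply/H => i iltn; have := Hw (Ordinal iltn); rewrite /signed /=.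
  by case: (s i) => // -[nB|nB /exceeds_noisy //]; exact/exceeds_noisy.
apply: (prob_sections nu productTheta) => i x; rewrite /signed /factor.
  by case: (s i) => [[]|] //; exact: measurableC.
by case: (s i) => [[]|] //; exact: probability_setT.
Qed.

Lemma prob_exceeds0 v : prob P (exceeds X 0 v) = mean nu (G v).
Proof.
rewrite (@prob_pattern 1 (fun=> Some true) v) => [|w].
  by congr mean; apply/funext => x; rewrite big_ord1.
by split=> [Hw [|i] //|/(_ 0%N isT)].
Qed.

Lemma prob_block_below0 l v : prob P (block_below X 0 l v) = mean nu (survival T (G v) l).
Proof.
by rewrite (@prob_pattern l (fun=> Some false) v) // => w; rewrite block_belowE.
Qed.

(** A gap of at least one keeps time zero out of the block, so the exceedance and the survival
    involve different noise vectors; the times in between stay free and contribute the factor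
    one. *)
Lemma prob_exceeds_block t l v :
  prob P (exceeds X 0 v `&` block_below X t.+1 l v) =
  mean nu (fun x => G v x * survival T (G v) l (iter t.+1 T x)).
Proof.
pose s i := if i == 0%N then Some true else if (t < i)%N then Some false else None.
rewrite (@prob_pattern (t.+1 + l) s v) => [|w]; last first.
  rewrite block_belowE; split=> [[H0 H] [|i] il //|H].
    by rewrite /s /=; case: ifP => // ti; apply: H; rewrite ti.
  split=> [|i /andP[ti il]]; first by have := H 0%N isT.
  by have := H i il; rewrite /s ti; case: i ti {il}.
congr mean; apply/funext => x; rewrite big_split_ord /= big_ord_recl /=.
rewrite [X in _ * X * _]big1 => [|i _]; last first.
  by rewrite /factor /s /= /bump add1n ltnS leqNgt (ltn_ord i).
rewrite mulr1; congr (_ * _); apply: eq_bigr => i _.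
by rewrite /factor /s /= addSn ltnS leq_addr -!iterS -iterD addnS addnC.
Qed.

Lemma prob_exceeds_exceeds j v :
  prob P (exceeds X 0 v `&` exceeds X j.+1 v) =
  mean nu (fun x => G v x * G v (iter j.+1 T x)).
Proof.
pose s i := if (i == 0%N) || (i == j.+1) then Some true else None.
rewrite (@prob_pattern j.+2 s v) => [|w]; last first.
  split=> [[H0 H] i il|H].
    by rewrite /s; case: ifP => // /orP[]/eqP ->.
  split; first by have := H 0%N isT.
  by have := H j.+1 (ltnSn _); rewrite /s eqxx orbT.
congr mean; apply/funext => x; rewrite big_ord_recl big_ord_recr /= big1 => [|i _]; last first.
  by rewrite /factor /s /= /bump add1n eqSS (ltn_eqF (ltn_ord i)).
by rewrite mul1r /factor /s /= /bump add1n eqxx.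
Qed.

Hypothesis mixT : mixing T nu.
Variables (K iota tau : R) (u : nat -> R).
Hypothesis K0 : 0 <= K.
Hypothesis kapK : forall A, measurable A -> (kap A <= K%:E * Leb A)%E.
Hypothesis iota0 : 0 < iota.
Hypothesis nu_iota : forall A, measurable A ->
  ((iota^-1)%:E * Leb A <= nu A)%E /\ (nu A <= iota%:E * Leb A)%E.
Hypothesis tau0 : 0 < tau.
Hypothesis mp : m%:R * prob P (exceeds X 0 (u m)) @[m --> \oo] --> tau.

Local Notation p m := (mean nu (G (u m))).
Local Notation volm m := (vol N (expR (- u m))).

Let mG v : measurable_fun setT (G v).
Proof. exact: measurable_hit. Qed.

Let G01 v x : 0 <= G v x <= 1.
Proof. by rewrite hit_ge0 hit_le1. Qed.

Let mp' : m%:R * p m @[m --> \oo] --> tau.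
Proof. by move: mp; under eq_cvg do rewrite prob_exceeds0. Qed.

Let integral_Leb_le (h : Omega -> \bar R) : measurable_fun setT h -> (forall x, 0 <= h x)%E ->
  (\int[Leb]_x h x <= iota%:E * \int[nu]_x h x)%E.
Proof.
move=> mh h0; apply: (ge0_integral_le_map (f := id) (ltW iota0)) => // A mA.
rewrite setTI preimage_id.
have := (nu_iota mA).1; rewrite -(@lee_pmul2l _ iota%:E) ?lte_fin// muleA -EFinM.
by rewrite divff ?gt_eqF// mul1e.
Qed.

Let integral_nu_le (h : Omega -> \bar R) : measurable_fun setT h -> (forall x, 0 <= h x)%E ->
  (\int[nu]_x h x <= iota%:E * \int[Leb]_x h x)%E.
Proof.
move=> mh h0; apply: (ge0_integral_le_map (f := id) (ltW iota0)) => // A mA.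
by rewrite setTI preimage_id; exact: (nu_iota mA).2.
Qed.

Let meanE f : bdd f -> (mean nu f)%:E = (\int[nu]_x (f x)%:E)%E.
Proof.
move=> bf; rewrite /mean /Rintegral fineK//.
by apply: integrable_fin_num => //; exact: (bdd_integrable nu bf).
Qed.

Let vol_ge0 m : 0 <= volm m.
Proof. exact: fine_ge0. Qed.

(** The volume is the Lebesgue integral of the hitting probability, and Lebesgue measure is at most
    [iota] times [nu]. *)
Let vol_le m : volm m <= iota * p m.
Proof.
rewrite -lee_fin EFinM (meanE (bdd_rate (mG _) (G01 _))).
rewrite -(integral_hit N kap); apply: integral_Leb_le.
  by apply/measurable_EFinP; exact: mG.
by move=> x; rewrite lee_fin hit_ge0.
Qed.

Let p_ge0 m : 0 <= p m.
Proof. by apply: mean_ge0 => x; have /andP[] := G01 (u m) x. Qed.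

(** One constant for both [G <= K1 * p] and [vol <= K1 * p]; the added [1] serves the latter when
    [K] is small. *)
Let K1 := (K + 1) * iota.
Let K1_ge0 : 0 <= K1.
Proof. by rewrite mulr_ge0 ?addr_ge0// ltW. Qed.

Let vol_le_K1 m : volm m <= K1 * p m.
Proof.
rewrite (le_trans (vol_le m))// ler_wpM2r// /K1 ler_peMl ?(ltW iota0)//.
by rewrite lerDr.
Qed.

Let G_le m x : G (u m) x <= K1 * p m.
Proof.
rewrite (le_trans (hit_le N kapK _ _))// /K1 -mulrA.
rewrite (@le_trans _ _ ((K + 1) * volm m))//; first by rewrite ler_wpM2r// lerDl.
by rewrite ler_wpM2l// addr_ge0.
Qed.

(** Since [p] tends to zero, so does the volume of the ball, whereas a ball of radius [r0] has
    positive volume. Thus the levels tend to infinity. *)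
Let radius_small r0 : 0 < r0 -> \forall m \near \oo, expR (- u m) <= r0.
Proof.
move=> r00; have V0 : 0 < vol N r0.
  by rewrite -lte_fin volE; exact: lebesgue_tball_gt0.
have V1 : 0 < vol N r0 / (2 * iota) by rewrite divr_gt0// mulr_gt0.
have := mean_level_small mp' V1.
apply: filterS => m pm; rewrite leNgt; apply/negP => rm.
have : vol N r0 <= volm m.
  rewrite -lee_fin !volE; apply: le_measure; rewrite ?inE; [exact: measurable_tball..|].
  exact: (tball_subset (ltW rm)).
have := vol_le m; move: pm; rewrite ler_pdivlMr ?mulr_gt0//.
by lra.
Qed.

Let G_approx e : 0 < e -> exists (g : Omega -> R) (b : nat -> R),
  averaging nu T g /\ \forall m \near \oo, [/\ 0 <= b m, b m <= K1 * p m &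
    mean nu (fun x => `|G (u m) x - b m * g x|) <= e * p m].
Proof.
(* One factor [iota] pays for passing from Lebesgue measure to [nu], the other for replacing the
   volume by [p]. *)
move=> e0; have e1 : 0 < e / (iota * iota) by rewrite divr_gt0// mulr_gt0.
have [n [A [c [r0 [mA c0 r00 HA]]]]] := hit_approx N kapK e1.
pose g x := \sum_(i < n) c * \1_(A i) x : R.
have Ag : averaging nu T g.
  exact: (averaging_sum mT _ (fun i => averagingZ mT c
    (averaging_indic mT invT mixT (mA i)))).
exists g, (fun m => volm m); split=> //.
apply: filterS (radius_small r00) => m rm; split=> //.
have bf : bdd (fun x => `|G (u m) x - volm m * g x|).
  by apply: bdd_norm; apply: bddB; [exact: bdd_rate|apply: bddZ; exact: Ag.1].
rewrite -lee_fin (meanE bf).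
apply: (le_trans (integral_nu_le _ _)).
- by apply/measurable_EFinP; exact: bf.1.
- by move=> x; rewrite lee_fin.
apply: (@le_trans _ _ (iota%:E * (e / (iota * iota) * volm m)%:E)%E).
  by rewrite lee_wpmul2l ?lee_fin ?(ltW iota0)//; exact: HA.
rewrite -EFinM lee_fin.
have -> : iota * (e / (iota * iota) * volm m) = e / iota * volm m.
  by field; rewrite gt_eqF.
by rewrite -mulrA ler_wpM2l ?(ltW e0)// ler_pdivrMl.
Qed.

Lemma noisy_conditions : condition_D2 P X u (fun=> 1%N) /\ condition_D' P X u (fun=> 1%N).
Proof.
split.
  apply: (condition_D2_of measurable_exceeds mp) => e e0.
  have := asymptotic_independence mT invT (fun m => mG (u m)) (fun m => G01 (u m))
    G_le K1_ge0 tau0 mp' G_approx e0.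
  apply: filterS => m Hm t l; have := Hm l t.+1.
  by rewrite /dependence prob_exceeds_block prob_exceeds0 prob_block_below0.
apply: (condition_D'_of mp K1_ge0) => m j.
rewrite prob_exceeds_exceeds prob_exceeds0.
have bG := bdd_rate (mG (u m)) (G01 (u m)).
have bGj := bdd_iter mT j.+1 bG.
rewrite -[X in _ <= _ * X](mean_iter mT invT j.+1 bG) -(meanZ nu _ bGj).
apply: mean_le; [exact: bddM|exact: bddZ|move=> x].
by rewrite ler_wpM2r//; have /andP[] := G01 (u m) (iter j.+1 T x).
Qed.

End noisy_process_theory.

Theorem proposition1 (R : realType) (d : nat) (N : vnorm R d)
    (T : torus R d -> torus R d) (nu : probability (torus R d) R)
    (theta : probability (noise N) R)
    (Theta : probability (seq_space (noise N)) R)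
    (eps : R) (z : torus R d) (tau : R) (u : nat -> R) :
  assumption_M N T nu ->
  assumption_N theta ->
  is_product_law theta Theta ->
  0 < eps ->
  0 < tau ->
  let P : probability (torus R d * seq_space (noise N))%type R :=
    (nu \x Theta)%E in
  let X : nat -> torus R d * seq_space (noise N) -> \bar R :=
    noisy_process T eps z in
  m%:R * prob P [set w | ((u m)%:E < X 0%N w)%E] @[m --> \oo] --> tau ->
  exists t_ : nat -> nat, condition_D2 P X u t_ /\ condition_D' P X u t_.
Proof.
move=> HM HN productTheta eps0 tau0 P X mp.
(* A lift of [z] makes the perturbed target the projection of an affine map. *)
have [a az] := to_torus_surj z; rewrite -az in X mp *.
have [rho [_ [[rhoL _ thetaE] _]]] := HN.
have [K K0 kapK] := noise_law_le a eps0 rhoL thetaE.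
have [iota iota0 nu_iota] := M_equivalent HM.
exists (fun=> 1%N).
exact: (noisy_conditions (M_measurable HM) (M_invariant HM) productTheta
  (M_mixing HM) K0 kapK iota0 nu_iota tau0 mp).
Qed.
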